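(* Let $d\in\mathbb{N}$, and let $\tau\ge d+1$ and $\ell>0$ be given. For $\boldsymbol{p}\in\mathscr{P}_\tau$ and $n\in\mathbb{N}$ let $\boldsymbol{K}\sim\mathrm{Multinomial}(n,\boldsymbol{p})$ and $\boldsymbol{Y}\sim\mathrm{Normal}_d(n\boldsymbol{p},n\Sigma_{\boldsymbol{p}})$. Then, for all $n\ge\tau^4$, $$\sup_{\boldsymbol{p}\in\mathscr{P}_\tau}\left|\mathbb{P}\left(\boldsymbol{\delta}_{\boldsymbol{K},\boldsymbol{p}}^\top\Sigma_{\boldsymbol{p}}^{-1}\boldsymbol{\delta}_{\boldsymbol{K},\boldsymbol{p}}\le\ell\right)-\mathbb{P}\left(\boldsymbol{\delta}_{\boldsymbol{Y},\boldsymbol{p}}^\top\Sigma_{\boldsymbol{p}}^{-1}\boldsymbol{\delta}_{\boldsymbol{Y},\boldsymbol{p}}\le\ell\right)\right|\le\frac{1.26\,\tau^3(d+1)(\log n)^{3/2}}{n^{1/2}}.$$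
   Context: $\mathcal{S}_d=\{\boldsymbol{s}\in[0,1]^d:\sum_{i=1}^d s_i\le1\}$, $\mathcal{S}_d^o=\{\boldsymbol{s}\in(0,1)^d:\sum_{i=1}^d s_i<1\}$, and $s_{d+1}:=1-\sum_{i=1}^d s_i$ for $\boldsymbol{s}\in\mathcal{S}_d$. $\mathscr{P}_\tau:=\{\boldsymbol{s}\in\mathcal{S}_d^o:\max_{1\le i\le d+1}s_i^{-1}\le\tau\}$. $\mathrm{Multinomial}(n,\boldsymbol{p})$ is the distribution on $\mathbb{N}_0^d\cap n\mathcal{S}_d$ (first $d$ of $d+1$ category counts) with mass function $P_{n,\boldsymbol{p}}(\boldsymbol{k})=\frac{n!}{\prod_{i=1}^{d+1}k_i!}\prod_{i=1}^{d+1}p_i^{k_i}$, where $k_{d+1}:=n-\sum_{i=1}^dk_i$ and $p_{d+1}:=1-\sum_{i=1}^dp_i$. $\Sigma_{\boldsymbol{p}}:=\mathrm{diag}(\boldsymbol{p})-\boldsymbol{p}\boldsymbol{p}^\top$. For $\boldsymbol{y}\in\mathbb{R}^d$, $\boldsymbol{\delta}_{\boldsymbol{y},\boldsymbol{p}}:=\frac{1}{\sqrt n}(\boldsymbol{y}-n\boldsymbol{p})$. (The statistic $\boldsymbol{\delta}_{\boldsymbol{K},\boldsymbol{p}}^\top\Sigma_{\boldsymbol{p}}^{-1}\boldsymbol{\delta}_{\boldsymbol{K},\boldsymbol{p}}$ is Pearson's chi-square statistic $\sum_{i=1}^{d+1}(K_i-np_i)^2/(np_i)$ with $K_{d+1}=n-\sum_{i=1}^dK_i$.)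 *)

(* Defs.v *)
From HB Require Import structures.
From mathcomp Require Import all_boot all_order all_algebra.
From mathcomp Require Import all_classical all_reals all_analysis.

Set Implicit Arguments.
Unset Strict Implicit.
Unset Printing Implicit Defensive.

Import Order.TTheory GRing.Theory Num.Theory.
Import numFieldNormedType.Exports.

Local Open Scope classical_set_scope.
Local Open Scope ring_scope.

Section append.
Context {T : Type}.

(* (f_1, ..., f_d, x), a family of d + 1 entries *)
Definition append d (f : 'I_d -> T) (x : T) : 'I_d.+1 -> T :=
  fun i => if unlift ord_max i is Some j then f j else x.

Lemma append_max d (f : 'I_d -> T) x : append f x ord_max = x.
Proof. by rewrite /append unlift_none. Qed.

Lemma append_lift d (f : 'I_d -> T) x j : append f x (lift ord_max j) = f j.
Proof. by rewrite /append liftK. Qed.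

End append.

Section simplex.
Context {R : realType} (d : nat).
Implicit Types p : 'cV[R]_d.

(* (p_1, ..., p_{d+1}) with p_{d+1} = 1 - p_1 - ... - p_d *)
Definition full_prob p : 'I_d.+1 -> R :=
  append (fun i => p i 0) (1 - \sum_(i < d) p i 0).

Definition open_simplex : set 'cV[R]_d :=
  [set p | (forall i, 0 < p i 0 < 1) /\ \sum_(i < d) p i 0 < 1].

(* On the open simplex all the inverses are positive, so starting the maximum
   from 0 is harmless. *)
Definition prob_set (tau : R) : set 'cV[R]_d :=
  [set p | open_simplex p /\
           \big[Order.max/0]_(i < d.+1) (full_prob p i)^-1 <= tau].

Definition Sigma p : 'M[R]_d := diag_mx p^T - p *m p^T.

Definition delta (n : nat) (y p : 'cV[R]_d) : 'cV[R]_d :=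
  (Num.sqrt n%:R)^-1 *: (y - n%:R *: p).

Definition pearson (n : nat) (y p : 'cV[R]_d) : R :=
  ((delta n y p)^T *m invmx (Sigma p) *m delta n y p) 0 0.

End simplex.

(* Random vectors are tuple-valued: n.-tuple T carries the product
   sigma-algebra. measurableTypeR R is R with the Borel sigma-algebra on which
   lebesgue_measure is defined. *)
Notation rvec R d := (d.-tuple (measurableTypeR R)).

Definition col_of_tuple (R : realType) d (y : rvec R d) : 'cV[R]_d :=
  \col_i (tnth y i : R).

Definition col_of_ntuple (R : realType) d (k : d.-tuple nat) : 'cV[R]_d :=
  \col_i (tnth k i)%:R.

Section multinomial.
Context {R : realType} (d n : nat) (p : 'cV[R]_d).
Implicit Types k : d.-tuple nat.

Definition full_count k : 'I_d.+1 -> nat :=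
  append (tnth k) (n - \sum_(i < d) tnth k i)%N.

Definition multinomial_pmf k : R :=
  if (\sum_(i < d) tnth k i <= n)%N then
    (n`!)%:R / (\prod_(i < d.+1) (full_count k i)`!)%:R *
    \prod_(i < d.+1) full_prob p i ^+ full_count k i
  else 0.

End multinomial.

Definition is_multinomial (R : realType) (disp : measure_display)
    (T : measurableType disp) (P : probability T R) (d n : nat) (p : 'cV[R]_d)
    (K : {RV P >-> d.-tuple nat}) : Prop :=
  forall k : d.-tuple nat,
    P [set w | K w = k] = (multinomial_pmf n p k)%:E.

Section lebesgue_tuple.
Context {R : realType}.

Definition tcons d (xy : measurableTypeR R * rvec R d) : rvec R d.+1 :=
  [tuple of xy.1 :: xy.2].

Definition tuncons d (y : rvec R d.+1) : measurableTypeR R * rvec R d :=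
  (thead y, [tuple of behead y]).

Lemma tconsK d : cancel (@tcons d) (@tuncons d).
Proof. by case=> x y; rewrite /tuncons theadE; congr pair; exact: val_inj. Qed.

Lemma measurable_tcons d : measurable_fun setT (@tcons d).
Proof. exact: measurable_cons. Qed.

Lemma measurable_tuncons d : measurable_fun setT (@tuncons d).
Proof.
apply/measurable_fun_pairP; split=> /=; last exact: measurable_behead.
exact: measurable_tnth.
Qed.

Section step.
Context (d : nat) (mu : {sigma_finite_measure set (rvec R d) -> \bar R}).

Definition lebesgue_cons : set (rvec R d.+1) -> \bar R :=
  pushforward (@lebesgue_measure R \x mu)%E (@tcons d).

Let tconsm (A : set (rvec R d.+1)) : measurable A ->
  measurable (@tcons d @^-1` A).
Proof.
by move=> mA; rewrite -[X in measurable X]setTI; exact: measurable_tcons.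
Qed.

Let lebesgue_cons0 : lebesgue_cons set0 = 0%E.
Proof. by rewrite /lebesgue_cons /pushforward preimage_set0 measure0. Qed.

Let lebesgue_cons_ge0 A : (0 <= lebesgue_cons A)%E.
Proof. by rewrite /lebesgue_cons /pushforward measure_ge0. Qed.

Let lebesgue_cons_sigma_additive : semi_sigma_additive lebesgue_cons.
Proof.
move=> F mF tF mUF; rewrite /lebesgue_cons /pushforward preimage_bigcup.
apply: measure_semi_sigma_additive.
- by move=> n; exact: tconsm.
- apply/trivIsetP => /= i j _ _ ij; rewrite -preimage_setI.
  by move/trivIsetP : tF => /(_ _ _ _ _ ij) ->//; rewrite preimage_set0.
- by rewrite -preimage_bigcup; exact: tconsm.
Qed.

HB.instance Definition _ := isMeasure.Build _ _ _ lebesgue_cons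
  lebesgue_cons0 lebesgue_cons_ge0 lebesgue_cons_sigma_additive.

Let lebesgue_cons_sigma_finite : sigma_finite setT lebesgue_cons.
Proof.
have /sigma_finiteP[F [TF ndF Foo]] := sigma_finiteT mu.
have /sigma_finiteP[G [TG ndG Goo]] := sigma_finiteT (@lebesgue_measure R).
exists (fun k => @tuncons d @^-1` (G k `*` F k)).
  rewrite -preimage_bigcup [X in _ @^-1` X](_ : _ = setT) ?preimage_setT//.
  apply/seteqP; split=> // -[x y] _.
  have [i _ Gx] : (\bigcup_i G i) x by rewrite -TG.
  have [j _ Fy] : (\bigcup_i F i) y by rewrite -TF.
  exists (maxn i j) => //; split => /=.
    by move: x Gx; exact/subsetPset/ndG/leq_maxl.
  by move: y Fy; exact/subsetPset/ndF/leq_maxr.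
move=> k; have [mG Gk] := Goo k; have [mF Fk] := Foo k; split.
  rewrite -[X in measurable X]setTI; apply: measurable_tuncons => //.
  exact: measurableX.
rewrite /lebesgue_cons /pushforward -comp_preimage.
rewrite (_ : tuncons (d:=d) \o _ = id) ?preimage_id; last first.
  by apply/funext => x /=; rewrite tconsK.
by rewrite product_measure1E// lte_mul_pinfty// ge0_fin_numE.
Qed.

HB.instance Definition _ :=
  Measure_isSigmaFinite.Build _ _ _ lebesgue_cons lebesgue_cons_sigma_finite.

End step.

(* Lebesgue measure on R^d, as an iterated product of the one on R *)
Fixpoint lebesgue_tuple (d : nat) :
    {sigma_finite_measure set (rvec R d) -> \bar R} :=
  match d with
  | 0%N => \d_ ([tuple] : rvec R 0)
  | d'.+1 => lebesgue_cons (lebesgue_tuple d')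
  end.

Lemma lebesgue_tuple_box d (A : 'I_d -> set (measurableTypeR R)) :
  (forall i, measurable (A i)) ->
  lebesgue_tuple d [set y | forall i, A i (tnth y i)] =
  (\prod_(i < d) lebesgue_measure (A i))%E.
Proof.
elim: d A => [|d IH] A mA.
  by rewrite big_ord0 /= diracE mem_set// => -[].
rewrite big_ord_recl -IH//= /lebesgue_cons /pushforward.
rewrite -product_measure1E//; last first.
  rewrite (_ : mkset _ = \bigcap_(i in [set: 'I_d])
      ((fun y : rvec R d => tnth y i) @^-1` A (lift ord0 i))).
    apply: fin_bigcap_measurable => // i _.
    by rewrite -[X in measurable X]setTI; exact: measurable_tnth.
  by apply/seteqP; split=> y /= h i => [_|]; exact: h.
congr product_measure1; apply/seteqP; split=> -[x y] /=.
  move=> h; split; first by have := h ord0.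
  by move=> i; have := h (lift ord0 i); rewrite tnthS.
case=> hx hy i; case: (unliftP ord0 i) => [j ->|->]; last by [].
by rewrite tnthS; exact: hy.
Qed.

End lebesgue_tuple.
Arguments lebesgue_tuple R d : clear implicits.

Definition mvnormal_pdf (R : realType) d (m : 'cV[R]_d) (S : 'M[R]_d)
    (y : 'cV[R]_d) : R :=
  (Num.sqrt ((2 * pi) ^+ d * \det S))^-1 *
  expR (- 2^-1 * ((y - m)^T *m invmx S *m (y - m)) 0 0).

(* for positive definite S only: singular normal laws have no density *)
Definition is_mvnormal (R : realType) (disp : measure_display)
    (T : measurableType disp) (P : probability T R) (d : nat)
    (m : 'cV[R]_d) (S : 'M[R]_d) (Y : {RV P >-> rvec R d}) : Prop :=
  forall A : set (rvec R d), measurable A ->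
    P [set w | A (Y w)] =
    (\int[lebesgue_tuple R d]_(y in A)
       (mvnormal_pdf m S (col_of_tuple y))%:E)%E.

(* Main.v *)
Require Import Defs.
From HB Require Import structures.
From mathcomp Require Import all_boot all_order all_algebra.
From mathcomp Require Import all_classical all_reals all_analysis.
From mathcomp Require Import measurable_realfun ring lra.

Set Implicit Arguments.
Unset Strict Implicit.
Unset Printing Implicit Defensive.

Import Order.TTheory GRing.Theory Num.Theory.
Import numFieldNormedType.Exports.

Local Open Scope classical_set_scope.
Local Open Scope ring_scope.

(** Let N be the norm on R^d whose square is the quadratic form of Sigma_p^-1, so
    that Pearson's statistic of y is N (y - n p)^2 / n; by Sherman-Morrison it is the
    familiar sum of (y_i - n p_i)^2 / (n p_i) over the d + 1 categories, and
    det Sigma_p is the product of the p_i.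

    The heart of the proof is a one-sided comparison of each atom of the multinomial
    law with the normal mass of the unit cube about it: with G the normal law,
    P(K = k) (1 - eps(k)) <= G(cube k), lemma [pmf_le_cube_mass].  Two facts combine.
    First, Stirling's formula bounds P(K = k) by the normal density at k times
    expR of the sum over i of |t_i| + n p_i |t_i|^3 / 6 (plus O(1/n)), where
    t_i = (k_i - n p_i) / (n p_i), lemma [multinomial_pmf_le]; this upper bound
    holds for all k with t_i >= - 1/2.  Secondly, the normal mass of a
    cube is almost at least the density at its centre, because the linear term of
    the exponent is odd about the centre, lemma [gauss_cube_ge].  The remaining atoms,
    with some t_i < - 1/2, satisfy eps(k) >= 1 trivially.

    One-sidedness suffices: summing over an event A bounds P(K in A) by the normal
    mass of the union of the cubes plus E eps(K), and applying this to the complement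
    of A gives the reverse inequality, lemma [multinomial_le_normal].  The tails are
    controlled on average: up to a term of order 1/n, eps can be taken as
    (tau + tau^2) / sqrt n times the sum of 2 cosh ((K_i - n p_i) / sqrt n), and the
    expectations of these are bounded through the multinomial theorem, lemma
    [multinomial_mgf_le].  Thus E eps(K) is at most 25 tau^2 (d + 1) / sqrt n.

    The cubes spread the ball of radius sqrt ell by at most
    eta = tau (d + 1) / (2 sqrt n) in the norm N / sqrt n, so it remains to bound the
    normal mass of a shell of width eta.  Dilating a ball by s >= 1 multiplies its mass
    by at most s^d, and a ball of radius r has mass at most 2 r; together these bound
    the shell by 2 d eta <= tau^2 (d + 1) / sqrt n, lemma [radial_annulus_le].

    The total 26 tau^2 (d + 1) / sqrt n is below the stated rate once ln n >= 5, and
    for smaller n the stated rate is at least 1. *)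

(** * Elementary inequalities for the logarithm and the exponential *)

Section real_inequalities.
Context {R : realType}.
Implicit Types x y t r : R.

Lemma le_of_derive_ge0 (f df : R -> R) (a b : R) : 0 < a -> a <= b ->
  (forall y, 0 < y -> is_derive y 1 f (df y)) ->
  (forall y, a <= y <= b -> 0 <= df y) -> f a <= f b.
Proof.
move=> a0 ab fd dfge.
have pos y : y \in `[a, b] -> 0 < y.
  by rewrite in_itv/= => /andP[ay _]; exact: lt_le_trans ay.
rewrite -subr_ge0; have [] := @MVT_segment _ f df a b ab.
- move=> y /[!in_itv]/= /andP[ay _]; apply: fd; exact: lt_trans ay.
- apply: continuous_in_subspaceT => y /set_mem/= /pos y0.
  apply: differentiable_continuous; apply/derivable1_diffP.
  by have [] := fd y y0.
move=> y /[!in_itv]/= /dfge dfy ->; apply: mulr_ge0 => //.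
by rewrite subr_ge0.
Qed.

Lemma ln_le_sub1 r : 0 < r -> ln r <= r - 1.
Proof. by move=> r0; have := @le_ln1Dx R (r - 1); rewrite [1 + _]addrC subrK; apply; lra. Qed.

Lemma ln_ge_subV r : 0 < r -> 1 - r^-1 <= ln r.
Proof.
move=> r0; have := @ln_le_sub1 r^-1; rewrite invr_gt0 lnV ?posrE// => /(_ r0).
lra.
Qed.

Lemma lin_mul_ln_is_derive (c : R) y : 0 < y ->
  is_derive y 1 (fun s => (s + c) * ln s) (ln y + 1 + c / y).
Proof.
move=> y0; have dln := is_derive1_ln y0.
rewrite (_ : (fun _ => _) = (id + cst c) * @ln R)//.
apply: is_derive_eq; rewrite /GRing.scale/= !fctE.
by field; rewrite gt_eqF.
Qed.

Lemma cubic_is_derive (a b c : R) y :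
  is_derive y 1 (fun s => a * (s - 1) + b * (s - 1) ^+ 2 + c * (s - 1) ^+ 3)
    (a + 2 * b * (y - 1) + 3 * c * (y - 1) ^+ 2).
Proof.
rewrite (_ : (fun _ => _) = (a \*: (id - cst 1) + b \*: (id - cst 1) ^+ 2 +
   c \*: (id - cst 1) ^+ 3 : R -> R))//.
apply: is_derive_eq; rewrite /GRing.scale/= !fctE.
by ring.
Qed.

Let is_derive_sub (f g : R -> R) (df dg y : R) : is_derive y 1 f df ->
  is_derive y 1 g dg -> is_derive y 1 (fun s => f s - g s) (df - dg).
Proof. by move=> hf hg; exact: (is_deriveB hf hg). Qed.

(** The right-hand side over r is the trapezoid rule for the integral of 1/x
    over [1, r], which overestimates because 1/x is convex. *)
Lemma ln_le_trapezoid r : 1 <= r -> r * ln r <= (r ^+ 2 - 1) / 2.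
Proof.
move=> r1.
suff : 0 <= - ((r + 0) * ln r - (1 * (r - 1) + 2^-1 * (r - 1) ^+ 2 + 0 * (r - 1) ^+ 3)).
  rewrite addr0 oppr_ge0; lra.
pose f s : R := (1 * (s - 1) + 2^-1 * (s - 1) ^+ 2 + 0 * (s - 1) ^+ 3) - (s + 0) * ln s.
have : f 1 <= f r.
  apply: (@le_of_derive_ge0 f (fun y => (1 + 2 * 2^-1 * (y - 1) +
      3 * 0 * (y - 1) ^+ 2) - (ln y + 1 + 0 / y)) 1 r ltr01 r1).
    move=> y y0; exact: is_derive_sub (cubic_is_derive _ _ _ _) (lin_mul_ln_is_derive _ y0).
  move=> y /andP[y1 _]; have := @ln_le_sub1 y; rewrite mul0r; lra.
rewrite /f ln1; lra.
Qed.

(** The [1/1] Pade approximant of the logarithm at 1: it is what makes the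
    factorial normalized by (m / e) ^ m * sqrt m decreasing. *)
Lemma ln_ge_pade r : 1 <= r -> 2 * (r - 1) <= (r + 1) * ln r.
Proof.
move=> r1.
pose f s : R := (s + 1) * ln s - (2 * (s - 1) + 0 * (s - 1) ^+ 2 + 0 * (s - 1) ^+ 3).
have : f 1 <= f r.
  apply: (@le_of_derive_ge0 f (fun y => (ln y + 1 + 1 / y) -
     (2 + 2 * 0 * (y - 1) + 3 * 0 * (y - 1) ^+ 2)) 1 r ltr01 r1).
    move=> y y0; exact: is_derive_sub (lin_mul_ln_is_derive _ y0) (cubic_is_derive _ _ _ _).
  move=> y /andP[y1 _]; have := @ln_ge_subV y; rewrite mul1r; lra.
rewrite /f ln1; lra.
Qed.

Let quad_ln_is_derive y : 0 < y -> is_derive y 1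
  (fun s => ln s - (1 * (s - 1) + (- 2^-1) * (s - 1) ^+ 2 + 0 * (s - 1) ^+ 3))
  (y^-1 - (1 + 2 * (- 2^-1) * (y - 1) + 3 * 0 * (y - 1) ^+ 2)).
Proof.
move=> y0; exact: is_derive_sub (is_derive1_ln y0) (cubic_is_derive _ _ _ _).
Qed.

Let quad_ln_derive_ge0 y : 0 < y ->
  0 <= y^-1 - (1 + 2 * (- 2^-1) * (y - 1) + 3 * 0 * (y - 1) ^+ 2).
Proof.
move=> y0; rewrite [X in 0 <= X](_ : _ = (y - 1) ^+ 2 / y).
  by rewrite divr_ge0 ?sqr_ge0// ltW.
by field; rewrite gt_eqF.
Qed.

Lemma ln_ge_quadratic r : 1 <= r -> (r - 1) - (r - 1) ^+ 2 / 2 <= ln r.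
Proof.
move=> r1.
have := le_of_derive_ge0 ltr01 r1 quad_ln_is_derive
  (fun y yr => quad_ln_derive_ge0 (lt_le_trans ltr01 (andP yr).1)).
rewrite ln1; lra.
Qed.

Lemma ln_le_quadratic r : 0 < r <= 1 -> ln r <= (r - 1) - (r - 1) ^+ 2 / 2.
Proof.
move=> /andP[r0 r1].
have := le_of_derive_ge0 r0 r1 quad_ln_is_derive
  (fun y yr => quad_ln_derive_ge0 (lt_le_trans r0 (andP yr).1)).
rewrite ln1; lra.
Qed.

(** The second derivative of r ln r is 1/r >= 1 - (r - 1), so its Taylor polynomial
    at 1 with this cubic term is a global lower bound.  This yields an upper
    bound of the mass function without restricting to a neighbourhood of the mean. *)
Lemma mul_ln_ge_cubic r : 0 < r ->
  (r - 1) + (r - 1) ^+ 2 / 2 - (r - 1) ^+ 3 / 6 <= r * ln r.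
Proof.
move=> r0.
pose f s : R := (s + 0) * ln s - (1 * (s - 1) + 2^-1 * (s - 1) ^+ 2 + (- 6^-1) * (s - 1) ^+ 3).
pose df y : R := (ln y + 1 + 0 / y) -
     (1 + 2 * 2^-1 * (y - 1) + 3 * (- 6^-1) * (y - 1) ^+ 2).
have fd y : 0 < y -> is_derive y 1 f (df y).
  move=> y0; exact: is_derive_sub (lin_mul_ln_is_derive _ y0) (cubic_is_derive _ _ _ _).
suff : f 1 <= f r by rewrite /f ln1; lra.
have [r1|/ltW r1] := leP 1 r.
  apply: le_of_derive_ge0 fd _ => // y /andP[y1 _].
  by rewrite /df mul0r; have := ln_ge_quadratic y1; lra.
rewrite -lerN2.
apply: (@le_of_derive_ge0 (- f) (- df)) => // y.
  by move=> y0; apply: is_deriveN; exact: fd.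
move=> /andP[ry y1]; rewrite !fctE /df mul0r.
have := @ln_le_quadratic y; rewrite y1 (lt_le_trans r0 ry) => /(_ isT); lra.
Qed.

End real_inequalities.

Section exponential_bounds.
Context {R : realType}.

(** The rational inequality for the logarithm at 5/3 says ln (5/3) >= 1/2. *)
Lemma expR_half_natl_le k : expR (k%:R * 2^-1) <= (5 / 3) ^+ k :> R.
Proof.
have l : 2^-1 <= ln (5 / 3) :> R.
  have := @ln_ge_pade R (5 / 3) _; move=> /(_ _); lra.
have e : expR (2^-1) <= 5 / 3 :> R.
  by rewrite -[leRHS]lnK ?posrE ?ler_expR//; lra.
by rewrite expRM_natl lerXn2r ?nnegrE ?expR_ge0//; lra.
Qed.

Lemma expR2_le8 : expR 2 <= 8 :> R.
Proof.
have -> : 2 = 4%:R * 2^-1 :> R by lra.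
by apply: le_trans (expR_half_natl_le 4) _; lra.
Qed.

Lemma expR_half5_le : expR (5 / 2) <= 13 :> R.
Proof. by apply: le_trans (expR_half_natl_le 5) _; lra. Qed.

(** From expR x <= 1 / (1 - x); this is valid for arbitrarily negative x. *)
Lemma expR_le_quadratic (x : R) : x <= 2^-1 -> expR x <= 1 + x + 2 * x ^+ 2.
Proof.
move=> x2; have e := expR_ge1Dx (- x).
have y0 : 0 < 1 - x by lra.
have : expR x <= (1 - x)^-1.
  by rewrite -[expR x]invrK -expRN lef_pV2 ?posrE ?expR_gt0.
move=> /le_trans; apply.
rewrite -[leLHS]mul1r ler_pdivrMr//.
rewrite -subr_ge0 [leRHS](_ : _ = x ^+ 2 * (1 - 2 * x)); last by ring.
by rewrite mulr_ge0 ?sqr_ge0//; lra.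
Qed.

Lemma double_le_cosh (x : R) : 2 * `|x| <= expR x + expR (- x).
Proof.
wlog x0 : x / 0 <= x.
  move=> h; have [/h//|x0] := leP 0 x.
  have := h (- x); rewrite normrN opprK addrC; apply; lra.
rewrite ger0_norm//.
have h : 1 + x / 2 <= expR (x / 2) by exact: expR_ge1Dx.
have -> : expR x = expR (x / 2) ^+ 2 by rewrite -expRM_natl; congr expR; lra.
have h0 : 0 <= (expR (x / 2) - (1 + x / 2)) * (expR (x / 2) + (1 + x / 2)).
  by rewrite mulr_ge0//; lra.
have := expR_ge0 (- x); have := sqr_ge0 (1 - x / 2); nra.
Qed.

Lemma cube_le_cosh (x : R) : `|x| ^+ 3 / 6 <= expR x + expR (- x).
Proof.
wlog x0 : x / 0 <= x.
  move=> h; have [/h//|x0] := leP 0 x.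
  have := h (- x); rewrite normrN opprK addrC; apply; lra.
rewrite ger0_norm//.
have := expR_ge1Dxn 2 x0; rewrite (_ : 3`!%:R = 6)//.
have := expR_ge0 (- x); lra.
Qed.

End exponential_bounds.

(** * Wallis integrals *)

Section wallis.
Context {R : realType}.
Local Notation mu := (@lebesgue_measure R).

Definition wallis n : R := \int[mu]_(x in `[0, pi / 2]) sin x ^+ n.

Let pihalf_gt0 : 0 < pi / 2 :> R.
Proof. by rewrite divr_gt0// pi_gt0. Qed.

Let continuous_sinX n : continuous (fun x : R => sin x ^+ n).
Proof.
move=> x; apply: (@continuous_comp R R R (@sin R) (fun y => y ^+ n)).
  exact: continuous_sin.
exact: exprn_continuous.
Qed.

Let integrable_sinX n : mu.-integrable `[0, pi / 2] (EFin \o (fun x : R => sin x ^+ n)).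
Proof.
apply: continuous_compact_integrable; first exact: segment_compact.
exact/continuous_subspaceT/continuous_sinX.
Qed.

Lemma Rintegral_FTC2 (F f : R -> R) (a b : R) : a < b -> continuous f ->
  (forall x : R, is_derive x 1 F (f x)) ->
  \int[mu]_(x in `[a, b]) f x = F b - F a.
Proof.
move=> ab cf dF.
have cF : continuous F.
  move=> x; apply: differentiable_continuous; apply/derivable1_diffP.
  by have [] := dF x.
rewrite /Rintegral (@continuous_FTC2 _ f F)//.
- exact/continuous_subspaceT.
- split.
  + by move=> x _; have [] := dF x.
  + exact/cvg_at_right_filter/cF.
  + exact/cvg_at_left_filter/cF.
- by move=> x _; rewrite derive1E; have [] := dF x.
Qed.

Lemma wallis0 : wallis 0 = pi / 2.
Proof.
by rewrite /wallis (@Rintegral_FTC2 id) ?subr0.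
Qed.

Lemma wallis1 : wallis 1 = 1.
Proof.
have dF (x : R) : is_derive x 1 (- @cos R) (sin x ^+ 1).
  by rewrite expr1; apply: is_derive_eq; rewrite opprK.
rewrite /wallis (Rintegral_FTC2 pihalf_gt0 _ dF) ?fctE; last exact: continuous_sinX.
by rewrite cos_pihalf cos0; lra.
Qed.

(** The primitive - cos x * sin x ^+ n.+1 vanishes at both ends. *)
Lemma wallis_rec n : n.+2%:R * wallis n.+2 = n.+1%:R * wallis n.
Proof.
have intZ k (c : R) : mu.-integrable `[0, pi / 2] (EFin \o (fun x : R => c * sin x ^+ k)).
  rewrite (_ : _ \o _ = (fun x : R => c%:E * (EFin \o (fun x : R => (sin x ^+ k)%R)) x)%E).
    exact: integrableZl.
  by apply/funext => x /=; rewrite EFinM.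
apply/eqP; rewrite -subr_eq0 /wallis -!RintegralZl// -RintegralB//.
have dF (x : R) : is_derive x 1 (- ((@cos R) * (@sin R) ^+ n.+1))
    (n.+2%:R * sin x ^+ n.+2 - n.+1%:R * sin x ^+ n).
  apply: is_derive_eq; rewrite /GRing.scale/= !fctE.
  rewrite [sin x ^+ n.+2]exprS [sin x ^+ n.+1]exprS.
  transitivity (sin x * (sin x * sin x ^+ n) - n.+1%:R * cos x ^+ 2 * sin x ^+ n).
    by rewrite /=; ring.
  by rewrite cos2sin2; ring.
rewrite (Rintegral_FTC2 pihalf_gt0 _ dF); last first.
  by move=> x; apply: cvgB; (apply: cvgM; [exact: cvg_cst|exact: continuous_sinX]).
by rewrite !fctE cos_pihalf sin0 expr0n /= mul0r mulr0 oppr0 subrr.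
Qed.

Lemma wallis_decr n : wallis n.+1 <= wallis n.
Proof.
apply: le_Rintegral => // x; rewrite /= in_itv/= => /andP[x0 xpi].
rewrite exprS ler_piMl ?sin_le1//; apply: exprn_ge0.
by apply: sin_ge0_pi; rewrite x0 (le_trans xpi)//; have := pi_ge0 R; lra.
Qed.

(** By the recurrence, n.+1 * W_n.+1 * W_n does not depend on n. *)
Lemma wallisM n : n.+1%:R * (wallis n.+1 * wallis n) = pi / 2.
Proof.
elim: n => [|n IH]; first by rewrite wallis0 wallis1 !mul1r.
by rewrite mulrA wallis_rec -mulrA [wallis n * _]mulrC.
Qed.

Lemma wallis_double m :
  wallis m.*2 = pi / 2 * ((m.*2)`!%:R / (m`!%:R ^+ 2 * 4 ^+ m)).
Proof.
elim: m => [|m IH]; first by rewrite wallis0 double0 fact0 expr0; field.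
rewrite doubleS.
have /(canRL (mulKf _)) -> := wallis_rec m.*2; last by rewrite pnatr_eq0.
rewrite IH !factS !natrM exprMn.
have f0 k : (k`!%:R : R) != 0 by rewrite pnatr_eq0 -lt0n fact_gt0.
have -> : m.*2.+2 = (m.+1 * 2)%N by rewrite -doubleS muln2.
rewrite natrM -[m.+1]addn1 natrD.
have m0 : (m%:R + 1 : R) != 0 by rewrite gt_eqF// ltr_wpDl// ler0n.
by rewrite addn1 [4 ^+ m.+1]exprS; field; rewrite ?expf_neq0// ?f0 ?m0.
Qed.

(** Wallis' inequality, with m.+1 for m, in the form C(2m, m) / 4 ^ m <= 1 / sqrt (pi m):
    W_2m is pi / 2 times the left-hand side, and W_2m ^ 2 <= W_2m W_(2m - 1) = pi / (4 m). *)
Lemma central_binomial_le m :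
  m.+1%:R * pi * ((m.+1.*2)`!%:R / (m.+1`!%:R ^+ 2 * 4 ^+ m.+1)) ^+ 2 <= 1 :> R.
Proof.
set c := _ / _.
have c0 : 0 <= c by rewrite /c divr_ge0// mulr_ge0// exprn_ge0.
have W : wallis m.+1.*2 = pi / 2 * c by exact: wallis_double.
have := wallisM m.*2.+1; have := wallis_decr m.*2.+1; rewrite -doubleS W => d M.
have pi0 := pi_gt0 R.
have : m.+1.*2%:R * ((pi / 2 * c) * (pi / 2 * c)) <= pi / 2.
  rewrite -[leRHS]M ler_wpM2l// ler_wpM2l// mulr_ge0//; lra.
rewrite -muln2 natrM => h.
rewrite -(ler_pM2l (x := pi / 2)) ?mulr1; last by lra.
by rewrite [leLHS](_ : _ = m.+1%:R * 2%:R * (pi / 2 * c * (pi / 2 * c)))//; field.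
Qed.

End wallis.

(** * Two-sided control of the factorial *)

Section stirling.
Context {R : realType}.

(** The logarithm of m! / (sqrt m * (m / e) ^ m); by Stirling's formula it
    tends to ln (2 pi) / 2. *)
Definition stirling_defect (m : nat) : R :=
  ln m`!%:R - (m%:R + 2^-1) * ln m%:R + m%:R.

Let nat_gt0 (m : nat) : (0 < m)%N -> 0 < m%:R :> R.
Proof. by rewrite ltr0n. Qed.

Lemma stirling_defect_step m : (0 < m)%N ->
  stirling_defect m - stirling_defect m.+1 =
  (m%:R + 2^-1) * ln ((m%:R + 1) / m%:R) - 1.
Proof.
move=> /nat_gt0 m0; rewrite /stirling_defect factS natrM -[m.+1%:R]natr1.
have m1 : 0 < m%:R + 1 :> R by lra.
rewrite lnM ?posrE ?ltr0n ?fact_gt0// ln_div ?posrE//.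
by ring.
Qed.

Lemma stirling_defect_decr1 m : (0 < m)%N ->
  stirling_defect m.+1 <= stirling_defect m.
Proof.
move=> m1; have m0 := nat_gt0 m1; rewrite -subr_ge0 stirling_defect_step//.
set r := _ / _; have rE : r = 1 + m%:R^-1 by rewrite /r; field; rewrite gt_eqF.
have V0 : 0 < (m%:R : R)^-1 by rewrite invr_gt0.
have r1 : 1 <= r by rewrite rE; lra.
have := ln_ge_pade r1.
rewrite -(ler_pM2l (x := m%:R / 2)); last by rewrite divr_gt0.
rewrite (_ : m%:R / 2 * (2 * _) = 1); last by rewrite rE; field; rewrite gt_eqF.
rewrite (_ : m%:R / 2 * _ = (m%:R + 2^-1) * ln r); first lra.
by set l := ln r; rewrite rE; field; rewrite gt_eqF.
Qed.

Lemma stirling_defect_decr1_le m : (0 < m)%N ->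
  stirling_defect m - stirling_defect m.+1 <= 4^-1 * (m%:R^-1 - m.+1%:R^-1).
Proof.
move=> m1; have m0 := nat_gt0 m1; rewrite stirling_defect_step// -[m.+1%:R]natr1.
set r := _ / _; have rE : r = 1 + m%:R^-1 by rewrite /r; field; rewrite gt_eqF.
have V0 : 0 < (m%:R : R)^-1 by rewrite invr_gt0.
have r1 : 1 <= r by rewrite rE; lra.
have := ln_le_trapezoid r1.
set c := (m%:R + 2^-1) / r.
have c0 : 0 < c by rewrite /c divr_gt0//; lra.
rewrite -(ler_pM2l c0).
rewrite (_ : c * (r * _) = (m%:R + 2^-1) * ln r); last first.
  by rewrite /c; field; rewrite gt_eqF//; lra.
rewrite (_ : c * _ = 1 + 4^-1 * (m%:R^-1 - (m%:R + 1)^-1)); first lra.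
by rewrite /c rE; field; rewrite !gt_eqF//; lra.
Qed.

Lemma stirling_defect_decr m n : (0 < m <= n)%N ->
  stirling_defect n <= stirling_defect m.
Proof.
move=> /andP[m0]; elim: n => [|n IH]; first by case: m m0.
rewrite leq_eqVlt => /predU1P[->//|]; rewrite ltnS => mn.
by apply: le_trans (IH mn); apply: stirling_defect_decr1; exact: leq_trans mn.
Qed.

Lemma stirling_defect_decr_le m n : (0 < m <= n)%N ->
  stirling_defect m - stirling_defect n <= 4^-1 * (m%:R^-1 - n%:R^-1).
Proof.
move=> /andP[m0]; elim: n => [|n IH]; first by case: m m0.
rewrite leq_eqVlt => /predU1P[->|]; first by rewrite !subrr mulr0.
rewrite ltnS => mn; have n0 := leq_trans m0 mn.
have := stirling_defect_decr1_le n0; have := IH mn.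
move: (stirling_defect m) (stirling_defect n) (stirling_defect n.+1).
by move: (n%:R^-1 : R) (n.+1%:R^-1 : R) (m%:R^-1 : R) => x y z a b c; lra.
Qed.

(** The central binomial coefficient is the quotient in which the factors
    (m / e) ^ m cancel, so Wallis' inequality bounds
    2 b_m - b_2m, where b is the defect. *)
Lemma stirling_defect_double m : (0 < m)%N ->
  ln (2 * pi) / 2 <= 2 * stirling_defect m - stirling_defect m.*2.
Proof.
case: m => // m _.
have := @central_binomial_le R m.
set c := _ / _.
have f0 k : (k`!%:R : R) \in Num.pos by rewrite posrE ltr0n fact_gt0.
have f1 k : 0 < (k`!%:R : R) by rewrite ltr0n fact_gt0.
have pi0 := pi_gt0 R.
have m0 : 0 < m.+1%:R :> R by rewrite ltr0n.
have c0 : 0 < c by rewrite /c divr_gt0 ?mulr_gt0 ?exprn_gt0.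
have q0 : 0 < m.+1%:R * pi * c ^+ 2 by rewrite !mulr_gt0 ?exprn_gt0.
move=> h; have : ln (m.+1%:R * pi * c ^+ 2) <= 0.
  by rewrite -(@ln1 R) ler_ln ?posrE.
rewrite lnM ?posrE ?exprn_gt0// ?mulr_gt0// lnM ?posrE// lnXn//.
have -> : ln c = ln (m.+1.*2)`!%:R - (ln m.+1`!%:R *+ 2 + ln 4 *+ m.+1).
  rewrite /c ln_div ?posrE//.
  by rewrite lnM ?posrE ?exprn_gt0// !lnXn.
have -> : ln 4 = ln 2 + ln 2 :> R.
  by rewrite -lnM ?posrE//; congr ln; rewrite -natrM.
rewrite /stirling_defect -[m.+1.*2]muln2 natrM !lnM ?posrE//.
rewrite -[ln m.+1`!%:R *+ 2]mulr_natr -[(ln 2 + ln 2) *+ _]mulr_natr -[_ *+ 2]mulr_natr.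
set a := ln _`!%:R; set b := ln _`!%:R; set x := ln _; set y := ln 2; set z := ln pi.
rewrite -[2%:R]/(2 : R).
lra.
Qed.

(** With b for the defect, b_n = (2 b_n - b_2n) - (b_n - b_2n), where the first
    term is at least ln (2 pi) / 2 and the second at most 1 / (4 n) by telescoping.
    Monotonicity then passes from n to k. *)
Lemma stirling_defect_ge k n : (0 < k <= n)%N ->
  ln (2 * pi) / 2 - (4 * n%:R)^-1 <= stirling_defect k.
Proof.
move=> /andP[k0 kn]; have n0 := leq_trans k0 kn.
apply: (le_trans _ (stirling_defect_decr (n := n) _)); last by rewrite k0.
have := stirling_defect_double n0.
have := @stirling_defect_decr_le n n.*2.
rewrite n0 -addnn leq_addr => /(_ isT).
rewrite invfM; have := nat_gt0 n0; rewrite -invr_gt0.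
have : 0 < ((n + n)%:R : R)^-1 by rewrite invr_gt0 nat_gt0// addn_gt0 n0.
lra.
Qed.

End stirling.

(** * Affine changes of variables in Euclidean space *)

Section lebesgue_affine.
Context {R : realType}.
Local Open Scope ereal_scope.

Lemma measurable_affine (c s : R) :
  measurable_fun setT (fun x : measurableTypeR R => (c + s * x)%R : measurableTypeR R).
Proof. by apply: measurable_funD => //; exact: measurable_funM. Qed.

(** Both sides are measures in A, so it is enough to compare them on the
    intervals that generate the Borel sets. *)
Lemma lebesgue_measure_affine (c s : R) (A : set (measurableTypeR R)) : s != 0%R ->
  measurable A ->
  lebesgue_measure A =
  `|s|%:E * pushforward (@lebesgue_measure R)
     (fun x : measurableTypeR R => (c + s * x)%R : measurableTypeR R) A.
Proof.
move=> s0 mA; have mphi := measurable_affine c s.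
set g := (fun x : measurableTypeR R => _) in mphi *.

pose push : {measure set (measurableTypeR R) -> \bar R} :=
  measure_function_pushforward__canonical__measure_function_Measure
    (@lebesgue_measure R) mphi.
pose nu : {measure set (measurableTypeR R) -> \bar R} :=
  mscale (NngNum (normr_ge0 s)) push.
apply: (@lebesgue_measure_unique R nu) => //= _ [[a b]] _ <-.
rewrite /nu /= /mscale/= /pushforward.
have [s_lt0|s_gt0|s_eq0] := ltgtP s 0%R; last by rewrite s_eq0 eqxx in s0.
  rewrite (_ : g @^-1` _ = `[((b - c) / s)%R, ((a - c) / s)%R[%classic).
    rewrite !lebesgue_measure_itv/= !lte_fin ltr_ndivrMr// mulrAC -mulrA divff ?lt_eqF//.
    rewrite mulr1 ltrBlDr subrK; case: ifPn => ab; last by rewrite mule0.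
    rewrite -!EFinD -EFinM ltr0_norm//; congr EFin; field; exact: s0.
  apply/seteqP; split=> x; rewrite /= !in_itv/= /g ler_ndivrMr// ltr_ndivlMr//.
    by rewrite ltrBlDl lerBrDl [(x * s)%R]mulrC => /andP[-> ->].
  by rewrite ltrBlDl lerBrDl [(x * s)%R]mulrC => /andP[-> ->].
rewrite (_ : g @^-1` _ = `]((a - c) / s)%R, ((b - c) / s)%R]%classic).
  rewrite !lebesgue_measure_itv/= !lte_fin ltr_pM2r ?invr_gt0// ltrD2r.
  case: ifPn => ab; last by rewrite mule0.
  rewrite -!EFinD -EFinM gtr0_norm//; congr EFin; field; exact: s0.
apply/seteqP; split=> x; rewrite /= !in_itv/= /g ler_pdivlMr// ltr_pdivrMr//.
  by rewrite ltrBlDl lerBrDl [(x * s)%R]mulrC => /andP[-> ->].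
by rewrite ltrBlDl lerBrDl [(x * s)%R]mulrC => /andP[-> ->].
Qed.

Lemma ge0_integral_affine (c s : R) (f : measurableTypeR R -> \bar R) : s != 0%R ->
  measurable_fun setT f -> (forall x, 0 <= f x) ->
  \int[lebesgue_measure]_x f x =
  `|s|%:E * \int[lebesgue_measure]_x f (c + s * x)%R.
Proof.
move=> s0 mf f0; have mphi := measurable_affine c s.
set g := (fun x : measurableTypeR R => _) in mphi *.
pose push : {measure set (measurableTypeR R) -> \bar R} :=
  measure_function_pushforward__canonical__measure_function_Measure
    (@lebesgue_measure R) mphi.
pose nu : {measure set (measurableTypeR R) -> \bar R} :=
  mscale (NngNum (normr_ge0 s)) push.
transitivity (\int[nu]_x f x).
  by apply: eq_measure_integral => A mA _; exact: lebesgue_measure_affine.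
rewrite /nu ge0_integral_mscale// /=; congr (_ * _).
rewrite /push /= ge0_integral_pushforward//.
Qed.

End lebesgue_affine.

Section lebesgue_tuple_affine.
Context {R : realType}.
Local Open Scope ereal_scope.

(** Tonelli's theorem for the first coordinate against the others. *)
Lemma ge0_integral_lebesgue_cons d (f : rvec R d.+1 -> \bar R) :
  measurable_fun setT f -> (forall x, 0 <= f x) ->
  \int[lebesgue_tuple R d.+1]_y f y =
  \int[lebesgue_measure]_x \int[lebesgue_tuple R d]_y f (tcons (x, y)).
Proof.
move=> mf f0 /=.
rewrite /lebesgue_cons ge0_integral_pushforward//; last exact: measurable_tcons.
rewrite preimage_setT /= fubini_tonelli1//.
by apply: measurableT_comp => //; exact: measurable_tcons.
Qed.

Definition affine_tuple d (c : 'I_d -> R) (s : R) (y : rvec R d) : rvec R d :=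
  [tuple (c i + s * tnth y i)%R | i < d].

Lemma measurable_affine_tuple d (c : 'I_d -> R) s :
  measurable_fun setT (affine_tuple c s).
Proof.
apply/measurable_fun_tnthP => i.
rewrite (_ : _ \o _ = (fun x => (c i + s * x)%R) \o (fun y => tnth y i)).
  apply: measurableT_comp; [exact: measurable_affine|exact: measurable_tnth].
by apply/funext => y /=; rewrite tnth_mktuple.
Qed.

(** Used with s > 0 for homotheties about the mean and with s = -1 for central
    symmetries of cubes. *)
Lemma ge0_integral_affine_tuple d (c : 'I_d -> R) (s : R) (f : rvec R d -> \bar R) :
  s != 0%R -> measurable_fun setT f -> (forall x, 0 <= f x) ->
  \int[lebesgue_tuple R d]_y f y =
  (`|s| ^+ d)%:E * \int[lebesgue_tuple R d]_y f (affine_tuple c s y).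
Proof.
move=> s0; elim: d c f => [|d IH] c f mf f0.
  rewrite expr0 mul1e; apply: eq_integral => y _.
  by congr f; rewrite [LHS]tuple0 [RHS]tuple0.
rewrite ge0_integral_lebesgue_cons//.
rewrite ge0_integral_lebesgue_cons//; last first.
  by apply: measurableT_comp => //; exact: measurable_affine_tuple.
have affE x y : affine_tuple c s (tcons (x, y)) =
    tcons ((c ord0 + s * x)%R, affine_tuple (fun i => c (lift ord0 i)) s y).
  apply: eq_from_tnth => i; rewrite tnth_mktuple.
  case: (unliftP ord0 i) => [j ->|->].
    by rewrite !tnthS tnth_mktuple.
  by rewrite !tnth0.
have mF (h : rvec R d.+1 -> \bar R) : measurable_fun setT h -> (forall x, 0 <= h x) ->
    measurable_fun setT (fun x => \int[lebesgue_tuple R d]_y h (tcons (x, y))).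
  move=> mh h0.
  apply: (@measurable_fun_fubini_tonelli_F _ _ _ _ _ (lebesgue_tuple R d) (h \o @tcons R d)) => //.
    by apply: measurableT_comp => //; exact: measurable_tcons.
  by move=> x; exact: h0.
rewrite (@ge0_integral_affine _ (c ord0) s)//; last 2 first.
  exact: mF.
  by move=> x; exact: integral_ge0.
rewrite exprS EFinM -muleA; congr (_ * _).
rewrite -ge0_integralZl//; last 2 first.
  apply: (mF (f \o affine_tuple c s)) => //.
    by apply: measurableT_comp => //; exact: measurable_affine_tuple.
  by move=> x; exact: f0.
  by move=> x _; exact: integral_ge0.
apply: eq_integral => x _.
rewrite [LHS](IH (fun i => c (lift ord0 i)))//; last first.
  by apply: measurableT_comp => //; apply: measurable_cons => //; exact: measurable_id.
by congr *%E; apply: eq_integral => y _; rewrite affE.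
Qed.

End lebesgue_tuple_affine.

(** * The multinomial covariance matrix *)

Lemma big_ord_append (T : Type) (idx : T) (op : Monoid.law idx) d (F : 'I_d.+1 -> T) :
  \big[op/idx]_(i < d.+1) F i =
  op (\big[op/idx]_(i < d) F (lift ord_max i)) (F ord_max).
Proof.
rewrite big_ord_recr; congr (op _ _); apply: eq_bigr => i _; congr F.
by apply: ord_inj; rewrite lift_max.
Qed.

Section covariance.
Context {R : realType} (d : nat).
Implicit Types p v : 'cV[R]_d.

Definition last_prob p : R := 1 - \sum_(i < d) p i 0.

Lemma full_prob_max p : full_prob p ord_max = last_prob p.
Proof. exact: append_max. Qed.

Lemma full_prob_lift p i : full_prob p (lift ord_max i) = p i 0.
Proof. exact: append_lift. Qed.

Lemma sum_full_prob p : \sum_i full_prob p i = 1.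
Proof.
rewrite big_ord_append full_prob_max /last_prob.
by rewrite (eq_bigr _ (fun i _ => full_prob_lift p i)) /= addrC subrK.
Qed.

Lemma full_prob_gt0 p i : open_simplex p -> 0 < full_prob p i.
Proof.
move=> [p01 p1]; case: (unliftP ord_max i) => [j ->|->].
  by rewrite full_prob_lift; have /andP[] := p01 j.
by rewrite full_prob_max subr_gt0.
Qed.

(** Bordering the matrix by a row and a column trades the rank one term for a
    triangular factorization, in two ways. *)
Lemma det_Sigma p : \det (Sigma p) = \prod_i full_prob p i.
Proof.
pose M : 'M[R]_(1 + d) := block_mx 1%:M p^T p (diag_mx p^T).
have E1 : M = block_mx 1%:M 0 p 1%:M *m block_mx 1%:M p^T 0 (Sigma p).
  rewrite mulmx_block !mulmx0 !mul0mx !mul1mx !mulmx1 !addr0 /M.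
  by rewrite /Sigma addrCA subrr addr0.
have E2 : M = block_mx (last_prob p)%:M p^T 0 (diag_mx p^T) *m
    block_mx 1%:M 0 (const_mx 1) 1%:M.
  rewrite mulmx_block !mulmx0 !mul0mx !mulmx1 !add0r /M; congr block_mx.
    apply/matrixP => i j; rewrite !ord1 !mxE /= mulr1n.
    rewrite (eq_bigr (fun i => p i 0)) => [|k _]; last by rewrite !mxE mulr1.
    by rewrite /last_prob subrK.
  apply/matrixP => i j; rewrite ord1 mul_diag_mx !mxE mulr1//.
have : \det M = \det M by [].
rewrite {1}E1 E2 !det_mulmx !det_lblock !det_ublock !det1 !mul1r !mulr1.
move=> ->; rewrite det_scalar expr1 det_diag big_ord_append full_prob_max mulrC.
by congr *%R; apply: eq_bigr => i _; rewrite mxE full_prob_lift.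
Qed.

Definition chi2_form p v : R :=
  \sum_(i < d) v i 0 ^+ 2 / p i 0 + (\sum_(i < d) v i 0) ^+ 2 / last_prob p.

(** Sherman-Morrison: the inverse of diag p - p p^T is diag (1 / p) plus the constant
    matrix with entries 1 / (1 - sum p). *)
Lemma Sigma_quad_form p v : open_simplex p ->
  (v^T *m invmx (Sigma p) *m v) 0 0 = chi2_form p v.
Proof.
move=> op.
have p0 i : p i 0 != 0.
  by have := full_prob_gt0 (lift ord_max i) op; rewrite full_prob_lift => /gt_eqF ->.
have a0 : last_prob p != 0.
  by have := full_prob_gt0 ord_max op; rewrite full_prob_max => /gt_eqF ->.
(* the explicit inverse *)
pose B : 'M[R]_d := \matrix_(i, j) ((i == j)%:R / p i 0 + (last_prob p)^-1).
have SB : Sigma p *m B = 1%:M.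
  apply/matrixP => i j; rewrite mulmxBl mul_diag_mx.
  have eB : (p *m p^T *m B) i j = p i 0 * (1 + (1 - last_prob p) / last_prob p).
    rewrite -mulmxA mxE big_ord1; congr *%R.
    rewrite mxE (eq_bigr (fun k => (k == j)%:R + p k 0 / last_prob p)).
      rewrite big_split/= -mulr_suml (bigD1 j)//= eqxx big1 ?addr0.
        by rewrite /last_prob opprB addrCA subrr addr0.
      by move=> k /negPf ->.
    by move=> k _; rewrite !mxE mulrDr mulrCA divff ?mulr1.
  rewrite mxE [X in _ + X]mxE eB !mxE.
  by case: eqVneq => _ /=; field; rewrite a0 p0.
have [uS _] := mulmx1_unit SB.
rewrite (_ : invmx _ = B); last first.
  by rewrite -[RHS](mulKmx uS) SB mulmx1.
rewrite -mulmxA mxE (eq_bigr (fun i => v i 0 ^+ 2 / p i 0 +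
    v i 0 * ((\sum_(j < d) v j 0) / last_prob p))); last first.
  move=> i _; rewrite !mxE expr2 -!mulrA -mulrDr; congr *%R.
  rewrite (eq_bigr (fun j => (i == j)%:R * (v j 0 / p i 0) + v j 0 / last_prob p)).
    rewrite big_split/= -mulr_suml (bigD1 i)//= eqxx big1 ?addr0 ?mul1r//.
    by move=> j /negPf; rewrite eq_sym => ->; rewrite mul0r.
  by move=> j _; rewrite !mxE; ring.
rewrite big_split/= -mulr_suml; congr +%R.
by rewrite mulrA expr2.
Qed.

Lemma pearsonE n (y p : 'cV[R]_d) : (0 < n)%N -> open_simplex p ->
  pearson n y p = chi2_form p (y - n%:R *: p) / n%:R.
Proof.
move=> n0 op; rewrite /pearson /delta.
rewrite -scalemxAr [(_ *: _)^T]linearZ/= -!scalemxAl scalerA mxE Sigma_quad_form//.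
by rewrite -invfM -expr2 sqr_sqrtr ?ler0n// mulrC.
Qed.

Lemma mvnormal_pdf_pearson n (y p : 'cV[R]_d) : (0 < n)%N -> open_simplex p ->
  mvnormal_pdf (n%:R *: p) (n%:R *: Sigma p) y =
  (Num.sqrt ((2 * pi * n%:R) ^+ d * \prod_i full_prob p i))^-1 *
  expR (- (pearson n y p / 2)).
Proof.
move=> n0 op; rewrite /mvnormal_pdf detZ det_Sigma mulrA -exprMn.
congr (_ * expR _).
have n1 : n%:R != 0 :> R by rewrite pnatr_eq0 -lt0n.
have uS : Sigma p \in unitmx.
  rewrite unitmxE det_Sigma unitfE; apply/prodf_neq0 => i _.
  by rewrite gt_eqF// full_prob_gt0.
rewrite invmxZ ?unitmxZ ?unitfE// -scalemxAr -scalemxAl mxE Sigma_quad_form//.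
by rewrite pearsonE// mulNr mulrC [n%:R^-1 * _]mulrC.
Qed.

End covariance.

(** * The multinomial theorem and exponential moments *)

Section multinomial_theorem.
Context {R : realType}.

Lemma big_tuple_cons (T : finType) (S : Type) (idx : S) (op : Monoid.com_law idx)
    d (P : pred (d.+1.-tuple T)) (F : d.+1.-tuple T -> S) :
  \big[op/idx]_(t : d.+1.-tuple T | P t) F t =
  \big[op/idx]_x \big[op/idx]_(u : d.-tuple T | P [tuple of x :: u]) F [tuple of x :: u].
Proof.
rewrite pair_big_dep/= (reindex (fun xu : T * d.-tuple T => [tuple of xu.1 :: xu.2])) //=.
exists (fun t : d.+1.-tuple T => (thead t, [tuple of behead t])).
  by move=> [x u] _; rewrite theadE; congr pair; exact: val_inj.
by move=> t _; rewrite -tuple_eta.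
Qed.

(** The multinomial theorem divided by m!, which turns the induction step into the
    binomial theorem.  The bound N on the entries is kept apart from the total m,
    since m decreases along the induction while the index type must not change. *)
Lemma sum_pow_fact_box (d N m : nat) (a : 'I_d -> R) (b : R) : (m <= N)%N ->
  \sum_(t : d.-tuple 'I_N.+1 | (\sum_(i < d) tnth t i <= m)%N)
    (\prod_(i < d) (a i ^+ tnth t i / (tnth t i)`!%:R)) *
    (b ^+ (m - \sum_(i < d) tnth t i)%N / (m - \sum_(i < d) tnth t i)`!%:R) =
  (\sum_(i < d) a i + b) ^+ m / m`!%:R.
Proof.
elim: d m a => [|d IH] m a mN.
  rewrite (big_pred1 [tuple]) => [|t]; last by rewrite big_ord0 /= [t]tuple0; apply/esym/eqP.
  by rewrite !big_ord0 subn0 mul1r add0r.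
rewrite big_tuple_cons [in RHS]big_ord_recl -addrA.
have f0 k : (k`!%:R : R) != 0 by rewrite pnatr_eq0 -lt0n fact_gt0.
transitivity (\sum_(x < N.+1 | (x < m.+1)%N) a ord0 ^+ x / x`!%:R *
    ((\sum_(i < d) a (lift ord0 i) + b) ^+ (m - x) / (m - x)`!%:R)).
  rewrite [RHS]big_mkcond; apply: eq_bigr => x _; rewrite ltnS.
  have sE (u : d.-tuple 'I_N.+1) :
      (\sum_(i < d.+1) tnth [tuple of x :: u] i = x + \sum_(i < d) tnth u i)%N.
    by rewrite big_ord_recl tnth0; congr addn; apply: eq_bigr => i _; rewrite tnthS.
  case: ifPn => xm; last first.
    rewrite big_pred0// => u; rewrite sE; apply/negP => /(leq_trans (leq_addr _ _)).
    exact/negP.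
  rewrite -(IH (m - x)%N) ?(leq_trans (leq_subr _ _))// mulr_sumr.
  apply: eq_big => [u|u _]; first by rewrite sE leq_subRL.
  rewrite sE subnDA big_ord_recl tnth0 -!mulrA; do 3 congr *%R.
  by apply: eq_bigr => i _; rewrite tnthS.
rewrite -(big_ord_widen _ (fun x => a ord0 ^+ x / x`!%:R *
    ((\sum_(i < d) a (lift ord0 i) + b) ^+ (m - x) / (m - x)`!%:R)))//.
rewrite [X in _ = X ^+ _ / _]addrC exprDn mulr_suml; apply: eq_bigr => i _.
have im : (i <= m)%N by rewrite -ltnS.
rewrite -mulr_natr -(bin_fact im) !natrM.
field; rewrite !f0 pnatr_eq0 -lt0n bin_gt0 im//.
Qed.

Lemma full_count_max d n (k : d.-tuple nat) :
  full_count n k ord_max = (n - \sum_(i < d) tnth k i)%N.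
Proof. exact: append_max. Qed.

Lemma full_count_lift d n (k : d.-tuple nat) i :
  full_count n k (lift ord_max i) = tnth k i.
Proof. exact: append_lift. Qed.

(** Tuples over 'I_n.+1 form a finite index type that contains every vector of
    counts of total at most n. *)
Definition count_of d n (t : d.-tuple 'I_n.+1) : d.-tuple nat := map_tuple val t.

Lemma multinomial_theorem d n (a : 'I_d.+1 -> R) :
  \sum_(t : d.-tuple 'I_n.+1 | (\sum_(i < d) tnth (count_of t) i <= n)%N)
    n`!%:R / (\prod_(i < d.+1) (full_count n (count_of t) i)`!)%:R *
    \prod_(i < d.+1) a i ^+ full_count n (count_of t) i = (\sum_i a i) ^+ n.
Proof.
have f0 k : (k`!%:R : R) != 0 by rewrite pnatr_eq0 -lt0n fact_gt0.
have /(congr1 (fun z => n`!%:R * z)) :=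
  @sum_pow_fact_box d n n (fun i => a (lift ord_max i)) (a ord_max) (leqnn n).
rewrite -big_ord_append mulrCA divff ?mulr1// => <-.
rewrite mulr_sumr; apply: eq_big => [t|t _].
  by congr leq; apply: eq_bigr => i _; rewrite tnth_map.
have sE : (\sum_(i < d) tnth (count_of t) i = \sum_(i < d) tnth t i)%N.
  by apply: eq_bigr => i _; rewrite tnth_map.
rewrite !big_ord_append natrM /= full_count_max sE natr_prod.
rewrite (eq_bigr (fun i => (tnth t i)`!%:R)) => [|i _]; last first.
  by rewrite full_count_lift tnth_map.
rewrite [X in _ * (X * _) = _](eq_bigr (fun i => a (lift ord_max i) ^+ tnth t i)) =>
  [|i _]; last first.
  by rewrite full_count_lift tnth_map.
by rewrite big_split/= prodfV invfM !mulrA -!mulrA; ring.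
Qed.

End multinomial_theorem.

Section multinomial_moments.
Context {R : realType} (d n : nat) (p : 'cV[R]_d).
Hypothesis op : open_simplex p.

Definition deviation (k : d.-tuple nat) (i : 'I_d.+1) : R :=
  (full_count n k i)%:R - n%:R * full_prob p i.

Lemma multinomial_pmf_ge0 k : 0 <= multinomial_pmf n p k.
Proof.
rewrite /multinomial_pmf; case: ifP => // _.
rewrite mulr_ge0 ?divr_ge0// prodr_ge0// => i _.
by rewrite exprn_ge0// ltW// full_prob_gt0.
Qed.

Lemma sum_multinomial_pmf :
  \sum_(t : d.-tuple 'I_n.+1) multinomial_pmf n p (count_of t) = 1.
Proof.
rewrite -big_mkcond /= (multinomial_theorem n (full_prob p)) sum_full_prob expr1n//.
Qed.

Lemma full_prob_le1 i : full_prob p i <= 1.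
Proof.
rewrite -(sum_full_prob p) (bigD1 i)//= lerDl sumr_ge0// => j _.
by rewrite ltW// full_prob_gt0.
Qed.

(** Weighting the i-th category by expR l turns the sum into the multinomial theorem,
    with value (1 + q_i (expR l - 1)) ^ n <= expR (n q_i (expR l - 1)). *)
Lemma multinomial_mgf_le i (l : R) : l <= 2^-1 ->
  \sum_(t : d.-tuple 'I_n.+1)
     multinomial_pmf n p (count_of t) * expR (l * deviation (count_of t) i)
  <= expR (2 * l ^+ 2 * n%:R).
Proof.
move=> l2; set q := full_prob p i.
(* the probabilities tilted towards the category i *)
pose a j := full_prob p j * (if j == i then expR l else 1).
have sa : \sum_j a j = 1 + q * (expR l - 1).
  rewrite (eq_bigr (fun j => full_prob p j + (if j == i then q * (expR l - 1) else 0))).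
    by rewrite big_split/= sum_full_prob -big_mkcond big_pred1_eq.
  by move=> j _; rewrite /a; case: eqP => [->|_]; rewrite /q; ring.
have -> : \sum_(t : d.-tuple 'I_n.+1)
     multinomial_pmf n p (count_of t) * expR (l * deviation (count_of t) i) =
    (\sum_j a j) ^+ n * expR (- (l * (n%:R * q))).
  rewrite -multinomial_theorem mulr_suml [RHS]big_mkcond/=; apply: eq_bigr => t _.
  rewrite /multinomial_pmf; case: ifP => _; last by rewrite mul0r.
  rewrite /deviation mulrBr expRD mulrA; congr (_ * _); rewrite -[LHS]mulrA; congr (_ * _).
  rewrite [RHS](eq_bigr (fun j => full_prob p j ^+ full_count n (count_of t) j *
      (if j == i then expR l ^+ full_count n (count_of t) i else 1))).
    by rewrite big_split/= -big_mkcond big_pred1_eq expRM_natr.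
  by move=> j _; rewrite exprMn; case: eqP => [->//|_]; rewrite expr1n.
have q0 : 0 < q by exact: full_prob_gt0.
have q1 : q <= 1 by exact: full_prob_le1.
rewrite sa; have h : 1 + q * (expR l - 1) <= expR (q * (expR l - 1)) by exact: expR_ge1Dx.
have h0 : 0 <= 1 + q * (expR l - 1).
  have := expR_gt0 l; nra.
apply: (@le_trans _ _ (expR (q * (expR l - 1)) ^+ n * expR (- (l * (n%:R * q))))).
  by rewrite ler_wpM2r ?expR_ge0// lerXn2r// nnegrE expR_ge0.
rewrite -expRM_natl -expRD ler_expR.
rewrite [leLHS](_ : _ = n%:R * (q * (expR l - 1 - l))); last by ring.
rewrite mulrC ler_wpM2r//.
have := expR_le_quadratic l2; have := sqr_ge0 l; nra.
Qed.

End multinomial_moments.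

(** * Upper bound for the multinomial mass function *)

Section local_limit.
Context {R : realType} (d n : nat) (p : 'cV[R]_d).
Hypotheses (op : open_simplex p) (n_gt0 : (0 < n)%N).
Local Notation q := (full_prob p).

Definition relative_deviation (k : d.-tuple nat) i : R :=
  deviation n p k i / (n%:R * q i).
Local Notation t := relative_deviation.

Let n0 : 0 < n%:R :> R. Proof. by rewrite ltr0n. Qed.
Let q0 i : 0 < q i. Proof. exact: full_prob_gt0. Qed.
Let nq0 i : 0 < n%:R * q i. Proof. by rewrite mulr_gt0. Qed.

Lemma sum_full_count k : (\sum_(i < d) tnth k i <= n)%N ->
  (\sum_(i < d.+1) full_count n k i = n)%N.
Proof.
move=> kn; rewrite big_ord_append full_count_max.
by rewrite (eq_bigr _ (fun i _ => full_count_lift n k i)) /= subnKC.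
Qed.

Lemma sum_deviation k : (\sum_(i < d) tnth k i <= n)%N ->
  \sum_(i < d.+1) deviation n p k i = 0.
Proof.
move=> kn; rewrite /deviation sumrB -natr_sum sum_full_count//.
by rewrite -mulr_sumr sum_full_prob mulr1 subrr.
Qed.

Lemma full_countE k i : (full_count n k i)%:R = n%:R * q i * (1 + t k i).
Proof.
rewrite /t /deviation mulrDr mulr1 mulrCA divff ?mulr1 ?gt_eqF//.
by rewrite addrC subrK.
Qed.

(** The density of Normal (n p, n Sigma) at its mean. *)
Definition gauss_const : R := (Num.sqrt ((2 * pi * n%:R) ^+ d * \prod_i q i))^-1.

Lemma ln_gauss_const :
  ln gauss_const = - (d%:R / 2 * (ln (2 * pi) + ln n%:R) + (\sum_i ln (q i)) / 2).
Proof.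
have pi0 := pi_gt0 R.
have prod0 : 0 < \prod_i q i by apply: prodr_gt0.
have c0 : 0 < (2 * pi * n%:R) ^+ d :> R by rewrite exprn_gt0 ?mulr_gt0.
have s0 : 0 < (2 * pi * n%:R) ^+ d * \prod_i q i :> R by rewrite mulr_gt0.
rewrite /gauss_const lnV ?posrE ?sqrtr_gt0//; congr (- _).
have -> : \sum_i ln (q i) = ln (\prod_i q i).
  rewrite -[LHS]expRK expR_sum; congr ln.
  by apply: eq_bigr => i _; rewrite lnK ?posrE.
set x := (2 * pi * n%:R) ^+ d * _ in s0 *.
have -> : ln (Num.sqrt x) = ln x / 2.
  have : ln (Num.sqrt x ^+ 2) = ln x by rewrite sqr_sqrtr// ltW.
  by rewrite lnXn ?sqrtr_gt0// => <-; rewrite mulr2n; lra.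
rewrite /x lnM ?posrE// lnXn ?mulr_gt0// lnM ?posrE ?mulr_gt0// -mulr_natr.
by ring.
Qed.

(** The contribution of one category to the logarithm of the mass function.  The
    terms full_count and deviation sum to n and to 0 over the categories, and the
    last line is the error. *)
Lemma log_count_term k i : (full_count n k i <= n)%N -> - 2^-1 <= t k i ->
  (full_count n k i)%:R * ln (q i) - ln (full_count n k i)`!%:R <=
  - stirling_defect n - ((full_count n k i)%:R + 2^-1) * ln n%:R - ln (q i) / 2
  + (full_count n k i)%:R - deviation n p k i
  - deviation n p k i ^+ 2 / (n%:R * q i) / 2
  + (`|t k i| + n%:R * q i * `|t k i| ^+ 3 / 6).
Proof.
move=> fn t2.
set f := full_count n k i in fn *.
set s := t k i in t2 *.
have fE : f%:R = n%:R * q i * (1 + s) by exact: full_countE.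
have f0 : 0 < f%:R :> R by rewrite fE mulr_gt0//; lra.
have devE : deviation n p k i = n%:R * q i * s.
  by rewrite /s /t mulrC divfK// gt_eqF.
have r0 : 0 < 1 + s by lra.
have := @stirling_defect_decr R f n; rewrite fn -(ltr0n R) f0 => /(_ isT).
rewrite {2}/stirling_defect.
have lnf : ln f%:R = ln n%:R + ln (q i) + ln (1 + s).
  by rewrite fE !lnM ?posrE.
have lnr : - ln (1 + s) <= 2 * `|s|.
  have := ln_ge_subV r0.
  have : (1 + s)^-1 <= 1 + 2 * `|s|.
    rewrite -[leLHS]mul1r ler_pdivrMr//.
    by have [s0|s0] := leP 0 s; [rewrite ger0_norm|rewrite ltr0_norm]; nra.
  lra.
have := mul_ln_ge_cubic r0; rewrite [1 + s - 1](_ : _ = s); last by ring.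
have s3 : s ^+ 3 <= `|s| ^+ 3 by rewrite -normrX ler_norm.
rewrite -(ler_pM2l (nq0 i)) => h.
have {}h : n%:R * q i * (s + s ^+ 2 / 2 - `|s| ^+ 3 / 6) <= f%:R * ln (1 + s).
  apply: le_trans (_ : _ <= n%:R * q i * ((1 + s) * ln (1 + s))) _.
    by apply: le_trans h; rewrite ler_pM2l//; lra.
  by rewrite fE mulrA.
rewrite lnf devE.
have -> : (n%:R * q i * s) ^+ 2 / (n%:R * q i) / 2 = n%:R * q i * (s ^+ 2 / 2).
  by field; rewrite gt_eqF//= gt_eqF.
move: h lnr; set A := n%:R * q i; set L := ln n%:R; set Q := ln (q i).
set F := ln f`!%:R; set X := ln (1 + s); set N3 := `|s| ^+ 3.
nra.
Qed.

(** The one-sided local limit theorem.  Of the d + 1 factorials in the denominator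
    one is absorbed by n!, as the defect is decreasing; the other d give the powers
    of 2 pi. *)
Lemma multinomial_pmf_le k : (\sum_(i < d) tnth k i <= n)%N ->
  (forall i, - 2^-1 <= t k i) ->
  multinomial_pmf n p k <=
  gauss_const * expR (- (\sum_i deviation n p k i ^+ 2 / (n%:R * q i) / 2)) *
  expR (\sum_i (`|t k i| + n%:R * q i * `|t k i| ^+ 3 / 6) + d%:R / (4 * n%:R)).
Proof.
move=> kn tk.
have f0 j : 0 < (j`!%:R : R) by rewrite ltr0n fact_gt0.
have pi0 := pi_gt0 R.
have gc0 : 0 < gauss_const.
  by rewrite invr_gt0 sqrtr_gt0 mulr_gt0 ?exprn_gt0 ?mulr_gt0// prodr_gt0.
have -> : multinomial_pmf n p k = expR (ln n`!%:R +
    \sum_i ((full_count n k i)%:R * ln (q i) - ln (full_count n k i)`!%:R)).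
  rewrite /multinomial_pmf kn expRD lnK ?posrE// -mulrA; congr *%R.
  rewrite expR_sum natr_prod -prodfV -big_split/=; apply: eq_bigr => i _.
  by rewrite expRB expRM_natl !lnK ?posrE// mulrC.
rewrite -[gauss_const]lnK ?posrE// ln_gauss_const -!expRD ler_expR.
have fn i : (full_count n k i <= n)%N.
  by rewrite -[leqRHS](sum_full_count kn) (bigD1 i)//= leq_addr.
have hS := @stirling_defect_ge R n n; rewrite n_gt0 leqnn in hS.
have {}hS := hS isT.
have -> : ln n`!%:R = stirling_defect n + (n%:R + 2^-1) * ln n%:R - n%:R :> R.
  by rewrite /stirling_defect; ring.
have sum_le : \sum_i ((full_count n k i)%:R * ln (q i) - ln (full_count n k i)`!%:R) <=
    \sum_i (- stirling_defect n - ((full_count n k i)%:R + 2^-1) * ln n%:R -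
      ln (q i) / 2 + (full_count n k i)%:R - deviation n p k i -
      deviation n p k i ^+ 2 / (n%:R * q i) / 2 +
      (`|t k i| + n%:R * q i * `|t k i| ^+ 3 / 6)).
  by apply: ler_sum => i _; exact: log_count_term.
move: (stirling_defect n) hS sum_le => S hS sum_le.
apply: (le_trans (lerD (lexx _) sum_le)).
have sum_cst (c : R) : \sum_(i < d.+1) c = d.+1%:R * c.
  by rewrite sumr_const card_ord mulr_natl.
rewrite !big_split/= !sumrN sum_deviation// -!mulr_suml big_split/=.
rewrite -natr_sum sum_full_count// !sum_cst.
set L := ln n%:R; set Q := \sum_i ln (q i).
set A := \sum_i _; set B := \sum_i _; set D := \sum_i _.
rewrite -[d.+1%:R]natr1 invfM.
move: hS; rewrite invfM; set P2 := ln (2 * pi).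
have : 0 <= d%:R :> R by [].
set dd : R := d%:R; set V := n%:R^-1; set N : R := n%:R.
move=> d0 h.
have : dd * (P2 / 2 - 4^-1 * V) <= dd * S by rewrite ler_wpM2l.
nra.
Qed.

End local_limit.

(** * The quadratic form of Pearson's statistic *)

Section chi2_form_geometry.
Context {R : realType} (d : nat) (p : 'cV[R]_d).
Hypothesis op : open_simplex p.
Implicit Types u v : 'cV[R]_d.

Let p0 i : 0 < p i 0.
Proof. by have := full_prob_gt0 (lift ord_max i) op; rewrite full_prob_lift. Qed.

Let last0 : 0 < last_prob p.
Proof. by have := full_prob_gt0 ord_max op; rewrite full_prob_max. Qed.

Lemma chi2_form_ge0 v : 0 <= chi2_form p v.
Proof.
rewrite addr_ge0// ?sumr_ge0// => [i _|]; first by rewrite divr_ge0 ?sqr_ge0// ltW.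
by rewrite divr_ge0 ?sqr_ge0// ltW.
Qed.

Lemma chi2_formZ (s : R) v : chi2_form p (s *: v) = s ^+ 2 * chi2_form p v.
Proof.
rewrite /chi2_form mulrDr mulr_sumr; congr (_ + _).
  by apply: eq_bigr => i _; rewrite mxE exprMn mulrA.
rewrite mulrA -exprMn mulr_sumr; congr (_ ^+ 2 / _).
by apply: eq_bigr => i _; rewrite mxE.
Qed.

Lemma chi2_form_parallelogram u v :
  chi2_form p (u + v) + chi2_form p (u - v) = 2 * (chi2_form p u + chi2_form p v).
Proof.
rewrite /chi2_form.
have sD : \sum_i (u + v) i 0 = \sum_i u i 0 + \sum_i v i 0.
  by rewrite -big_split/=; apply: eq_bigr => i _; rewrite mxE.
have sB : \sum_i (u - v) i 0 = \sum_i u i 0 - \sum_i v i 0.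
  by rewrite -sumrB; apply: eq_bigr => i _; rewrite !mxE.
rewrite sD sB.
have E : \sum_i (u + v) i 0 ^+ 2 / p i 0 + \sum_i (u - v) i 0 ^+ 2 / p i 0 =
    2 * (\sum_i u i 0 ^+ 2 / p i 0 + \sum_i v i 0 ^+ 2 / p i 0).
  rewrite -!big_split/= mulr_sumr; apply: eq_bigr => i _; rewrite !mxE; ring.
rewrite addrACA E; ring.
Qed.

(** The triangle inequality for the norm of the quadratic form, through
    (a + b)^2 <= (1 + e/s) a^2 + (1 + s/e) b^2 applied to each square. *)
Lemma chi2_formD_le (s e : R) u v : 0 < s -> 0 < e ->
  chi2_form p u <= s ^+ 2 -> chi2_form p v <= e ^+ 2 ->
  chi2_form p (u + v) <= (s + e) ^+ 2.
Proof.
move=> s0 e0 us ve.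
have sqrD_le (w a b : R) : 0 < w ->
    (a + b) ^+ 2 / w <= (1 + e / s) * (a ^+ 2 / w) + (1 + s / e) * (b ^+ 2 / w).
  move=> w0; rewrite -subr_ge0 [leRHS](_ : _ = (e * a - s * b) ^+ 2 / (s * e * w)).
    by rewrite divr_ge0 ?sqr_ge0// ltW// !mulr_gt0.
  by field; rewrite !gt_eqF.
have : chi2_form p (u + v) <= (1 + e / s) * chi2_form p u + (1 + s / e) * chi2_form p v.
  rewrite /chi2_form !mulrDr addrACA lerD//.
    rewrite !mulr_sumr -big_split/= ler_sum// => i _.
    by rewrite mxE sqrD_le.
  rewrite (eq_bigr (fun i => u i 0 + v i 0)) => [|i _]; last by rewrite mxE.
  by rewrite big_split/= sqrD_le.
move=> /le_trans; apply.
rewrite [leRHS](_ : _ = (1 + e / s) * s ^+ 2 + (1 + s / e) * e ^+ 2); last first.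
  by field; rewrite !gt_eqF.
have es : 0 < e / s by rewrite divr_gt0.
have se : 0 < s / e by rewrite divr_gt0.
by rewrite lerD// ler_pM2l//; lra.
Qed.

Lemma chi2_form_box_le (tau : R) u : (forall i, (full_prob p i)^-1 <= tau) ->
  (forall i, `|u i 0| <= 2^-1) ->
  chi2_form p u <= tau * d%:R * d.+1%:R / 4.
Proof.
move=> ptau u2.
have tp i : (p i 0)^-1 <= tau by have := ptau (lift ord_max i); rewrite full_prob_lift.
have tl : (last_prob p)^-1 <= tau by have := ptau ord_max; rewrite full_prob_max.
have half : 0 <= 2^-1 :> R by [].
have h1 : \sum_i u i 0 ^+ 2 / p i 0 <= d%:R * (tau / 4).
  rewrite mulr_natl -[X in _ *+ X](card_ord d) -sumr_const ler_sum// => i _.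
  rewrite mulrC ler_pM ?sqr_ge0 ?invr_ge0 ?(ltW (p0 _))//.
  have := u2 i; rewrite ler_norml => /andP[? ?]; nra.
have h2 : (\sum_i u i 0) ^+ 2 <= (d%:R / 2) ^+ 2.
  rewrite -real_normK ?num_real// lerXn2r ?nnegrE ?divr_ge0//.
  apply: (le_trans (ler_norm_sum _ _ _)).
  rewrite mulr_natl -[X in _ *+ X](card_ord d) -sumr_const ler_sum//.
have h3 : (\sum_i u i 0) ^+ 2 / last_prob p <= (d%:R / 2) ^+ 2 * tau.
  by rewrite ler_pM ?sqr_ge0 ?invr_ge0 ?(ltW last0).
rewrite -natr1; rewrite /chi2_form; nra.
Qed.

End chi2_form_geometry.

(** * Normal mass of balls and cubes *)

Section gaussian_mass.
Context {R : realType} (d n : nat) (p : 'cV[R]_d).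
Hypotheses (op : open_simplex p) (n_gt0 : (0 < n)%N).
Local Notation mu := (lebesgue_tuple R d).

Definition gauss_density (y : rvec R d) : R :=
  mvnormal_pdf (n%:R *: p) (n%:R *: Sigma p) (col_of_tuple y).
Definition chi2_stat (y : rvec R d) : R := pearson n (col_of_tuple y) p.
Local Notation Gauss := gauss_density.
Local Notation chi2 := chi2_stat.

Let n0 : 0 < n%:R :> R. Proof. by rewrite ltr0n. Qed.

Lemma GaussE y : Gauss y = gauss_const n p * expR (- (chi2 y / 2)).
Proof. exact: mvnormal_pdf_pearson. Qed.

Lemma gauss_const_ge0 : 0 <= gauss_const n p :> R.
Proof. by rewrite invr_ge0 sqrtr_ge0. Qed.

Lemma Gauss_ge0 y : 0 <= Gauss y.
Proof. by rewrite GaussE mulr_ge0 ?gauss_const_ge0 ?expR_ge0. Qed.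

Lemma chi2_ge0 y : 0 <= chi2 y.
Proof. by rewrite /chi2_stat pearsonE// divr_ge0 ?chi2_form_ge0// ltW. Qed.

Lemma measurable_chi2 : measurable_fun setT chi2.
Proof.
rewrite (_ : chi2 = fun y : rvec R d =>
  (\sum_(i < d) (tnth y i - n%:R * p i 0) ^+ 2 * (p i 0)^-1 +
  (\sum_(i < d) (tnth y i - n%:R * p i 0)) ^+ 2 * (last_prob p)^-1) * n%:R^-1); last first.
  apply/funext => y; rewrite /chi2_stat pearsonE//; congr (_ * _); congr (_ + _).
    by apply: eq_bigr => i _; rewrite !mxE.
  by congr (_ ^+ 2 * _); apply: eq_bigr => i _; rewrite !mxE.
have mi i : measurable_fun [set: rvec R d] (fun y => tnth y i - n%:R * p i 0).
  by apply: measurable_funB => //; exact: measurable_tnth.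
apply: measurable_funM => //; apply: measurable_funD.
  apply: measurable_sum => i; apply: measurable_funM => //.
  exact: measurable_funX.
apply: measurable_funM => //; apply: measurable_funX.
exact: measurable_sum.
Qed.

Lemma measurable_Gauss : measurable_fun setT (fun y => (Gauss y)%:E).
Proof.
apply/measurable_EFinP; rewrite (funext GaussE); apply: measurable_funM => //.
apply: measurableT_comp; first exact: measurable_expR.
rewrite (_ : (fun _ => _) = (fun y => chi2 y * (- 2^-1))); last first.
  by apply/funext => y; rewrite mulrN.
by apply: measurable_funM => //; exact: measurable_chi2.
Qed.

Definition chi2_ball (r : R) : set (rvec R d) := [set y | chi2 y <= r ^+ 2].

Lemma measurable_chi2_ball r : measurable (chi2_ball r).
Proof.
rewrite -[chi2_ball r]setTI.
exact: (@measurable_fun_ler _ _ _ setT chi2 (cst (r ^+ 2)) measurable_chi2 _ measurableT).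
Qed.

Lemma integral_affine_set (c : 'I_d -> R) (s : R) (A : set (rvec R d)) :
  s != 0 -> measurable A ->
  (\int[mu]_(y in A) (Gauss y)%:E = (`|s| ^+ d)%:E *
   \int[mu]_(y in affine_tuple c s @^-1` A) (Gauss (affine_tuple c s y))%:E)%E.
Proof.
move=> s0 mA; rewrite [in LHS]integral_mkcond [in RHS]integral_mkcond.
rewrite (ge0_integral_affine_tuple c s0).
- by congr *%E; apply: eq_integral => y _; rewrite /patch.
- apply/(measurable_restrictT (fun y => (Gauss y)%:E) mA).
  exact: measurable_funTS measurable_Gauss.
- by move=> y; rewrite /patch; case: ifP => // _; rewrite lee_fin Gauss_ge0.
Qed.

Lemma col_of_affine_tuple (c : 'I_d -> R) s y :
  col_of_tuple (affine_tuple c s y) = \col_i c i + s *: col_of_tuple y.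
Proof. by apply/matrixP => i j; rewrite !mxE tnth_mktuple. Qed.

(** The homothety of ratio s centred at the mean n p. *)
Definition dilate (s : R) : rvec R d -> rvec R d :=
  affine_tuple (fun i => (1 - s) * (n%:R * p i 0)) s.

Lemma chi2_dilate s y : chi2 (dilate s y) = s ^+ 2 * chi2 y.
Proof.
rewrite /chi2_stat !pearsonE// mulrA -chi2_formZ; congr (chi2_form _ _ / _).
by rewrite col_of_affine_tuple; apply/matrixP => i j; rewrite !mxE (ord1 j); ring.
Qed.

Lemma preimage_dilate s r : 0 < s -> dilate s @^-1` chi2_ball (s * r) = chi2_ball r.
Proof.
move=> s0; apply/seteqP; split=> y; rewrite /chi2_ball /=.
  by rewrite chi2_dilate exprMn ler_pM2l// exprn_gt0.
by rewrite chi2_dilate exprMn ler_pM2l// exprn_gt0.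
Qed.

Lemma gauss_ball_dilate (s r c : R) : 0 < s -> 0 <= c ->
  (forall y, chi2_ball r y -> Gauss (dilate s y) <= c * Gauss y) ->
  (\int[mu]_(y in chi2_ball (s * r)) (Gauss y)%:E <=
   (s ^+ d * c)%:E * \int[mu]_(y in chi2_ball r) (Gauss y)%:E)%E.
Proof.
move=> s0 c0 h; have -> : (\int[mu]_(y in chi2_ball (s * r)) (Gauss y)%:E =
    (s ^+ d)%:E * \int[mu]_(y in chi2_ball r) (Gauss (dilate s y))%:E)%E.
  rewrite -(preimage_dilate r s0) -{2}(gtr0_norm s0).
  by apply: integral_affine_set; [exact: lt0r_neq0|exact: measurable_chi2_ball].
rewrite EFinM -muleA.
rewrite lee_pmul2l ?lte_fin ?exprn_gt0//.
have mG := measurable_funTS measurable_Gauss.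
rewrite -ge0_integralZl//; last 2 first.
- exact: measurable_chi2_ball.
- by move=> y _; rewrite lee_fin Gauss_ge0.
apply: ge0_le_integral => //.
- exact: measurable_chi2_ball.
- by move=> y _; rewrite lee_fin Gauss_ge0.
- apply: measurable_funTS; apply: (measurableT_comp measurable_Gauss).
  exact: measurable_affine_tuple.
- by apply: emeasurable_funM => //.
Qed.

(** A dilation by s multiplies volumes by s ^ d and decreases the density. *)
Lemma gauss_ball_dilate_ge1 (s r : R) : 1 <= s ->
  (\int[mu]_(y in chi2_ball (s * r)) (Gauss y)%:E <=
   (s ^+ d)%:E * \int[mu]_(y in chi2_ball r) (Gauss y)%:E)%E.
Proof.
move=> s1; rewrite -[s ^+ d]mulr1; apply: gauss_ball_dilate => //; first by lra.
move=> y _; rewrite mul1r !GaussE chi2_dilate ler_wpM2l ?gauss_const_ge0//.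
have s2 : 1 <= s ^+ 2 by nra.
by rewrite ler_expR; have := chi2_ge0 y; nra.
Qed.

(** On the unit ball a contraction increases the density by at most expR (1/2) <= 2. *)
Lemma gauss_ball_dilate_le1 (s : R) : 0 < s <= 1 ->
  (\int[mu]_(y in chi2_ball s) (Gauss y)%:E <=
   (2 * s ^+ d)%:E * \int[mu]_(y in chi2_ball 1) (Gauss y)%:E)%E.
Proof.
move=> /andP[s0 s1]; rewrite -{1}[s]mulr1 [2 * _]mulrC.
apply: gauss_ball_dilate => // y; rewrite /chi2_ball/= expr1n => y1.
rewrite !GaussE chi2_dilate mulrCA ler_wpM2l ?gauss_const_ge0//.
apply: (@le_trans _ _ (expR (2^-1 - chi2 y / 2))).
  by rewrite ler_expR; have := chi2_ge0 y; nra.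
rewrite expRD ler_wpM2r ?expR_ge0//.
have := @expR_le_quadratic R 2^-1 (lexx _); lra.
Qed.

(** Averaging over two points symmetric about k kills the linear term of the
    exponent: by the parallelogram identity the mean exponent at k + u and k - u
    differs from the exponent at k by the quadratic form of u, and expR is convex. *)
Lemma gauss_midpoint (k y z : rvec R d) (M : R) :
  col_of_tuple z = 2 *: col_of_tuple k - col_of_tuple y ->
  chi2_form p (col_of_tuple y - col_of_tuple k) <= M ->
  2 * (Gauss k * expR (- (M / (2 * n%:R)))) <= Gauss y + Gauss z.
Proof.
move=> zE yM; rewrite !GaussE -mulrA -mulrDr mulrCA ler_wpM2l ?gauss_const_ge0//.
rewrite -expRD.
have amgm (a b : R) : 2 * expR ((a + b) / 2) <= expR a + expR b.
  have -> : (a + b) / 2 = a / 2 + b / 2 by lra.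
  have e (x : R) : expR x = expR (x / 2) ^+ 2.
    by rewrite -expRM_natl; congr expR; lra.
  rewrite expRD (e a) (e b).
  have := sqr_ge0 (expR (a / 2) - expR (b / 2)); nra.
apply: le_trans (amgm _ _); rewrite ler_pM2l// ler_expR.
suff : chi2 y + chi2 z <= 2 * (chi2 k + M / n%:R).
  have -> : M / (2 * n%:R) = M / n%:R / 2 by field; rewrite gt_eqF.
  lra.
rewrite /chi2_stat !pearsonE// -!mulrDl mulrA ler_pM2r ?invr_gt0//.
have := chi2_form_parallelogram p (col_of_tuple k - n%:R *: p) (col_of_tuple y - col_of_tuple k).
have -> : col_of_tuple k - n%:R *: p + (col_of_tuple y - col_of_tuple k) =
    col_of_tuple y - n%:R *: p.
  by apply/matrixP => i j; rewrite !mxE; ring.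
have -> : col_of_tuple k - n%:R *: p - (col_of_tuple y - col_of_tuple k) =
    col_of_tuple z - n%:R *: p.
  by rewrite zE; apply/matrixP => i j; rewrite !mxE; ring.
by move=> ->; lra.
Qed.

(** Open cubes about distinct integer points are disjoint, and they are
    symmetric about their centres. *)
Definition cube (k : rvec R d) : set (rvec R d) :=
  [set y | forall i, `]tnth k i - 2^-1, tnth k i + 2^-1[%classic (tnth y i)].

Lemma measurable_cube k : measurable (cube k).
Proof.
rewrite (_ : cube k = \bigcap_(i in [set: 'I_d])
    ((fun y : rvec R d => tnth y i) @^-1` `]tnth k i - 2^-1, tnth k i + 2^-1[%classic)).
  apply: fin_bigcap_measurable => // i _.
  by rewrite -[X in measurable X]setTI; exact: measurable_tnth.
by apply/seteqP; split=> y h i => [_|]; exact: h.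
Qed.

Lemma volume_cube k : mu (cube k) = 1%E.
Proof.
rewrite (@lebesgue_tuple_box _ _ (fun i => `]tnth k i - 2^-1, tnth k i + 2^-1[%classic))//.
rewrite big1// => i _.
rewrite lebesgue_measure_itv/= lte_fin ifT; last by lra.
by rewrite -EFinD; congr EFin; lra.
Qed.

(** The symmetry of the cube about k pairs each point with its mirror image. *)
Lemma gauss_cube_ge (k : rvec R d) (M : R) :
  (forall u : 'cV[R]_d, (forall i, `|u i 0| <= 2^-1) -> chi2_form p u <= M) ->
  ((Gauss k * expR (- (M / (2 * n%:R))))%:E <= \int[mu]_(y in cube k) (Gauss y)%:E)%E.
Proof.
move=> hM; set I := (\int[_]_(_ in _) _)%E.
have mG : measurable_fun (cube k) (fun y => (Gauss y)%:E).
  exact: measurable_funTS measurable_Gauss.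
(* the central symmetry about k *)
pose z (y : rvec R d) := affine_tuple (fun i => 2 * tnth k i) (- 1) y.
have zcube : z @^-1` cube k = cube k.
  apply/seteqP; split=> y /= h i; have := h i; rewrite /z tnth_mktuple/= !in_itv/=; lra.
have Iz : I = (\int[mu]_(y in cube k) (Gauss (z y))%:E)%E.
  rewrite /I (@integral_affine_set (fun i => 2 * tnth k i) (- 1)) ?oppr_eq0 ?oner_eq0//;
    last exact: measurable_cube.
  by rewrite -/z zcube normrN1 expr1n mul1e.
have mGz : measurable_fun (cube k) (fun y => (Gauss (z y))%:E).
  apply: measurable_funTS; apply: (measurableT_comp measurable_Gauss).
  exact: measurable_affine_tuple.
have : ((2 * (Gauss k * expR (- (M / (2 * n%:R)))))%:E <=
    \int[mu]_(y in cube k) (Gauss y)%:E + \int[mu]_(y in cube k) (Gauss (z y))%:E)%E.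
  have -> : (\int[mu]_(y in cube k) (Gauss y)%:E + \int[mu]_(y in cube k) (Gauss (z y))%:E =
      \int[mu]_(y in cube k) ((Gauss y)%:E + (Gauss (z y))%:E))%E.
    apply: esym; refine (ge0_integralD mu (measurable_cube k) _ mG _ mGz).
      by move=> y _; rewrite lee_fin Gauss_ge0.
    by move=> y _; rewrite lee_fin Gauss_ge0.
  rewrite -[leLHS]mule1 -(volume_cube k) -(integral_cst mu (measurable_cube k)).
  apply: (@ge0_le_integral _ _ _ mu _ (measurable_cube k)).
  - by move=> y _; rewrite lee_fin !mulr_ge0 ?Gauss_ge0 ?expR_ge0.
  - exact: measurable_cst.
  - exact: emeasurable_funD mG mGz.
  - move=> y ky; rewrite -EFinD lee_fin; apply: gauss_midpoint.
      by rewrite col_of_affine_tuple; apply/matrixP => i j; rewrite !mxE; ring.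
    apply: hM => i; have := ky i; rewrite !mxE/= in_itv/= ler_norml; lra.
rewrite -Iz -/I.
have : (0 <= I)%E by apply: integral_ge0 => y _; rewrite lee_fin Gauss_ge0.
clear Iz; case: I => [r| |] //=; last by move=> _ _; rewrite leey.
by rewrite -EFinD !lee_fin; lra.
Qed.

End gaussian_mass.

(** * Thin shells carry little mass *)

Section radial_anticoncentration.
Context {R : realType}.

Lemma bernoulli_ineq (x : R) d : 0 <= x <= 1 -> 1 - d%:R * x <= (1 - x) ^+ d.
Proof.
move=> /andP[x0 x1]; elim: d => [|d IH]; first by rewrite mul0r subr0.
rewrite exprS -natr1; have h : 0 <= 1 - x by lra.
apply: le_trans (ler_wpM2l h IH).
have : 0 <= d%:R :> R by []; nra.
Qed.

Context (d : nat) (F : R -> R).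
Hypotheses (d_gt0 : (0 < d)%N) (F01 : forall r, 0 <= F r <= 1).
Hypothesis F_dilate_ge1 : forall s r, 1 <= s -> F (s * r) <= s ^+ d * F r.
Hypothesis F_dilate_le1 : forall s, 0 < s <= 1 -> F s <= 2 * s ^+ d * F 1.

(** Only the bound for r <= 1 has content: there the mass is of order r ^ d <= r. *)
Lemma radial_mass_le r : 0 < r -> F r <= 2 * r.
Proof.
move=> r0; have [r1|r1] := leP r 1; last by have /andP[_] := F01 r; lra.
have := F_dilate_le1 (_ : 0 < r <= 1); rewrite r0 r1 => /(_ isT) /le_trans; apply.
have /andP[F0 F1] := F01 1.
have rd : r ^+ d <= r.
  by rewrite -[leRHS]expr1 ler_wiXn2l// ltW.
have rd0 : 0 <= r ^+ d by rewrite exprn_ge0// ltW.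
nra.
Qed.

(** F r >= (r / (r + a)) ^ d F (r + a), so the shell has mass at most
    F (r + a) * d a / (r + a) by Bernoulli's inequality, and F (r + a) <= 2 (r + a)
    cancels the denominator. *)
Lemma radial_annulus_le r a : 0 < r -> 0 < a -> F (r + a) <= F r + 2 * d%:R * a.
Proof.
move=> r0 a0; have ra0 : 0 < r + a by lra.
pose x := a / (r + a).
have xE : 1 - x = r / (r + a) by rewrite /x; field; rewrite gt_eqF.
have x0 : 0 < x by rewrite divr_gt0.
have x1 : 0 < 1 - x by rewrite xE divr_gt0.
have h : (1 - x) ^+ d * F (r + a) <= F r.
  have := @F_dilate_ge1 ((r + a) / r) r.
  rewrite divfK ?gt_eqF// ler_pdivlMr// mul1r => /(_ _).
  rewrite lerDl ltW// => /(_ isT) hF.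
  have := ler_wpM2l (ltW (exprn_gt0 d x1)) hF.
  rewrite mulrA -exprMn xE [r / _ * _](_ : _ = 1) ?expr1n ?mul1r//.
  by field; rewrite !gt_eqF.
have := @bernoulli_ineq x d; rewrite (ltW x0) (_ : x <= 1); last by lra.
move=> /(_ isT) b.
have /andP[Fra0 _] := F01 (r + a).
have Fra : F (r + a) * x <= 2 * a.
  have := radial_mass_le ra0.
  rewrite -(ler_pM2r x0) => /le_trans; apply.
  by rewrite [leLHS](_ : _ = 2 * a)// /x; field; rewrite gt_eqF.
have d0 : 0 <= d%:R :> R by [].
have := ler_wpM2l d0 Fra.
have : (1 - d%:R * x) * F (r + a) <= (1 - x) ^+ d * F (r + a) by rewrite ler_wpM2r.
nra.
Qed.

End radial_anticoncentration.

(** * Comparing atoms with cubes *)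

Section cube_comparison.
Context {R : realType} (d n : nat) (p : 'cV[R]_d) (tau : R).
Hypotheses (op : open_simplex p) (n_gt0 : (0 < n)%N).
Hypothesis tau_ge : forall i, (full_prob p i)^-1 <= tau.
Local Notation q := (full_prob p).
Local Notation sqn := (Num.sqrt (n%:R : R)).

Let n0 : 0 < n%:R :> R. Proof. by rewrite ltr0n. Qed.
Let q0 i : 0 < q i. Proof. exact: full_prob_gt0. Qed.
Let sqn0 : 0 < sqn. Proof. by rewrite sqrtr_gt0. Qed.
Let sqnE : n%:R = sqn ^+ 2. Proof. by rewrite sqr_sqrtr ?ler0n. Qed.

Lemma pearson_deviation k : (\sum_(i < d) tnth k i <= n)%N ->
  pearson n (col_of_ntuple R k) p = \sum_i deviation n p k i ^+ 2 / (n%:R * q i).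
Proof.
move=> kn; rewrite pearsonE// /chi2_form mulrDl big_ord_append /=.
have dl i : deviation n p k (lift ord_max i) = (col_of_ntuple R k - n%:R *: p) i 0.
  by rewrite /deviation full_count_lift full_prob_lift !mxE.
have dm : deviation n p k ord_max = - \sum_i (col_of_ntuple R k - n%:R *: p) i 0.
  have := sum_deviation p kn; rewrite big_ord_append /= => /eqP.
  rewrite addrC addr_eq0 => /eqP ->; congr (- _).
  by apply: eq_bigr => i _; rewrite dl.
congr (_ + _).
  rewrite mulr_suml; apply: eq_bigr => i _.
  by rewrite dl full_prob_lift -mulrA invfM [n%:R^-1 * _]mulrC.
by rewrite dm sqrrN full_prob_max -mulrA invfM [n%:R^-1 * _]mulrC.
Qed.

(** This is 2 cosh (x / sqrt n) at the deviation x of the i-th count. *)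
Definition cosh_deviation (k : d.-tuple nat) i : R :=
  expR (deviation n p k i / sqn) + expR (- (deviation n p k i / sqn)).

(** It dominates the error exponent of the mass function bound plus the loss of
    passing from a point to its cube; hyperbolic cosines serve as a majorant because
    their expectation comes from the multinomial theorem. *)
Definition local_error (k : d.-tuple nat) : R :=
  (d%:R / (4 * n%:R) + tau * d%:R * d.+1%:R / 4 / (2 * n%:R)) +
  \sum_i (tau + tau ^+ 2) / sqn * cosh_deviation k i.

Let tau0 : 0 < tau.
Proof. by apply: lt_le_trans (tau_ge ord_max); rewrite invr_gt0. Qed.

Lemma cosh_deviation_ge0 k i : 0 <= cosh_deviation k i.
Proof. by rewrite addr_ge0 ?expR_ge0. Qed.

Lemma relative_deviation_le k i :
  `|relative_deviation n p k i| <= tau / sqn * cosh_deviation k i / 2.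
Proof.
have h := @double_le_cosh R (deviation n p k i / sqn).
have -> : relative_deviation n p k i = (q i)^-1 / sqn * (deviation n p k i / sqn).
  rewrite /relative_deviation; have := sqn0; have := sqnE.
  by set s := sqn => -> s0; field; rewrite !gt_eqF.
rewrite normrM -mulrA; apply: ler_pM => //.
  rewrite normrM !gtr0_norm ?invr_gt0// ler_pM2r ?invr_gt0//.
by rewrite ler_pdivlMr// mulrC.
Qed.

Lemma cubic_deviation_le k i :
  n%:R * q i * `|relative_deviation n p k i| ^+ 3 / 6 <=
  tau ^+ 2 / sqn * cosh_deviation k i.
Proof.
have h := @cube_le_cosh R (deviation n p k i / sqn).
have -> : relative_deviation n p k i = (q i)^-1 / sqn * (deviation n p k i / sqn).
  rewrite /relative_deviation; have := sqn0; have := sqnE.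
  by set s := sqn => -> s0; field; rewrite !gt_eqF.
set x := deviation n p k i / sqn in h *.
rewrite normrM exprMn gtr0_norm ?mulr_gt0 ?invr_gt0//.
have -> : n%:R * q i * (((q i)^-1 / sqn) ^+ 3 * `|x| ^+ 3) / 6 =
    (q i)^-1 ^+ 2 / sqn * (`|x| ^+ 3 / 6).
  have := sqn0; have := sqnE.
  by set s := sqn => -> s0; field; rewrite !gt_eqF.
apply: ler_pM => //.
  by rewrite mulr_ge0 ?invr_ge0 ?exprn_ge0 ?invr_ge0 ?(ltW (q0 i)) ?(ltW sqn0).
rewrite ler_pM2r ?invr_gt0// lerXn2r// nnegrE ?invr_ge0 ltW//.
Qed.

Definition real_tuple (k : d.-tuple nat) : rvec R d := [tuple (tnth k i)%:R | i < d].

Lemma col_of_real_tuple k : col_of_tuple (real_tuple k) = col_of_ntuple R k.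
Proof. by apply/matrixP => i j; rewrite !mxE tnth_mktuple. Qed.

(** If every count is at least half its mean, Stirling's bound and the symmetry of the
    cube apply; otherwise local_error is at least 1 and the left-hand side is
    nonpositive. *)
Lemma pmf_le_cube_mass k : (\sum_(i < d) tnth k i <= n)%N ->
  ((multinomial_pmf n p k * (1 - local_error k))%:E <=
  \int[lebesgue_tuple R d]_(y in cube (real_tuple k)) (gauss_density n p y)%:E)%E.
Proof.
move=> kn.
have pmf0 : 0 <= multinomial_pmf n p k by exact: multinomial_pmf_ge0.
have c0 : 0 <= d%:R / (4 * n%:R) + tau * d%:R * d.+1%:R / 4 / (2 * n%:R).
  by rewrite addr_ge0// ?divr_ge0 ?mulr_ge0 ?(ltW n0) ?(ltW tau0).
have err0 i : 0 <= (tau + tau ^+ 2) / sqn * cosh_deviation k i.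
  by rewrite mulr_ge0 ?cosh_deviation_ge0// divr_ge0 ?(ltW sqn0)// addr_ge0 ?sqr_ge0// ltW.
have [/forallP tk|] := boolP [forall i, - 2^-1 <= relative_deviation n p k i].
  apply: (@le_trans _ _ (gauss_density n p (real_tuple k) *
      expR (- (tau * d%:R * d.+1%:R / 4 / (2 * n%:R))))%:E); last first.
    by apply: gauss_cube_ge => // u; exact: chi2_form_box_le.
  rewrite lee_fin; have h := multinomial_pmf_le op n_gt0 kn tk.
  set E := (X in _ <= _ * expR X) in h.
  have EG : gauss_density n p (real_tuple k) =
      gauss_const n p * expR (- (\sum_i deviation n p k i ^+ 2 / (n%:R * q i) / 2)).
    by rewrite GaussE// /chi2_stat col_of_real_tuple pearson_deviation// mulr_suml.
  rewrite -EG in h.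
  set M := tau * d%:R * d.+1%:R / 4 / (2 * n%:R).
  apply: (@le_trans _ _ (multinomial_pmf n p k * expR (- (E + M)))).
    rewrite ler_wpM2l//; apply: le_trans (expR_ge1Dx _).
    rewrite lerD2l lerN2 /E /local_error -/M.
    rewrite addrAC [leRHS]addrC [d%:R / _ + M]addrC [leRHS]addrA lerD2r//.
    rewrite lerD2r ler_sum// => i _.
    have := relative_deviation_le k i; have := cubic_deviation_le k i.
    have := mulr_ge0 (ltW (divr_gt0 tau0 sqn0)) (cosh_deviation_ge0 k i).
    rewrite !mulrDl; move: (_ * cosh_deviation k i) (_ * cosh_deviation k i) => a b; lra.
  have := ler_wpM2r (expR_ge0 (- (E + M))) h; move=> /le_trans; apply.
  rewrite -mulrA -expRD ler_wpM2l ?Gauss_ge0// ler_expR; lra.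
rewrite negb_forall => /existsP[i]; rewrite -ltNge => ti.
apply: (@le_trans _ _ 0%E); last by apply: integral_ge0 => y _; rewrite lee_fin Gauss_ge0.
rewrite lee_fin mulr_ge0_le0// subr_le0 /local_error.
apply: ler_wpDl => //; rewrite (bigD1 i)//=; apply: ler_wpDr.
  by apply: sumr_ge0 => j _.
have := relative_deviation_le k i.
have -> : `|relative_deviation n p k i| = - relative_deviation n p k i.
  by rewrite ltr0_norm//; apply: lt_trans ti _; lra.
have := mulr_ge0 (divr_ge0 (sqr_ge0 tau) (ltW sqn0)) (cosh_deviation_ge0 k i).
rewrite !mulrDl; move: (_ * cosh_deviation k i) (_ * cosh_deviation k i) => a b; lra.
Qed.

(** The exponential moments at -1 / sqrt n and 1 / sqrt n are at most expR 2 <= 8. *)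
Lemma sum_local_error_le : (4 <= n)%N ->
  \sum_(t : d.-tuple 'I_n.+1) multinomial_pmf n p (count_of t) * local_error (count_of t)
  <= (d%:R / (4 * n%:R) + tau * d%:R * d.+1%:R / 4 / (2 * n%:R)) +
     d.+1%:R * ((tau + tau ^+ 2) / sqn * 16).
Proof.
move=> n4.
under eq_bigr do rewrite /local_error mulrDr.
rewrite big_split/= -mulr_suml sum_multinomial_pmf// mul1r lerD2l.
under eq_bigr do rewrite mulr_sumr.
rewrite exchange_big/= [leRHS]mulr_natl -[X in _ <= _ *+ X](card_ord d.+1) -sumr_const.
apply: ler_sum => i _.
rewrite (eq_bigr (fun t => (tau + tau ^+ 2) / sqn * (multinomial_pmf n p (count_of t) *
   cosh_deviation (count_of t) i))); last by move=> t _; rewrite mulrCA.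
rewrite -mulr_sumr ler_wpM2l//.
  by rewrite divr_ge0 ?(ltW sqn0)// addr_ge0 ?sqr_ge0// ltW.
have sqn2 : 2 <= sqn.
  rewrite -[2](@ger0_norm R) // -sqrtr_sqr ler_wsqrtr//.
  by rewrite -natrX ler_nat.
have V0 : 0 < sqn^-1 by rewrite invr_gt0.
have V2 : sqn^-1 <= 2^-1 by rewrite lef_pV2 ?posrE.
have V2n : 2 * sqn^-1 ^+ 2 * n%:R = 2.
  have := sqn0; have := sqnE.
  by set s := sqn => -> s0; field; rewrite gt_eqF.
have e8 := @expR2_le8 R.
rewrite /cosh_deviation.
under eq_bigr do rewrite mulrDr.
rewrite big_split/=.
have := @multinomial_mgf_le R d n p op i sqn^-1 V2.
have := @multinomial_mgf_le R d n p op i (- sqn^-1) _.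
rewrite sqrrN V2n => /(_ _) h1 h2.
have {}h1 := h1 (_ : - sqn^-1 <= 2^-1).
have -> : 16 = 8 + 8 :> R by lra.
apply: lerD.
  apply: le_trans e8; apply: le_trans h2; apply: ler_sum => t _.
  by rewrite [sqn^-1 * _]mulrC.
apply: le_trans e8; apply: le_trans (h1 _); last by lra.
by apply: ler_sum => t _; rewrite mulNr [sqn^-1 * _]mulrC.
Qed.

End cube_comparison.

(** * Comparing events *)

Lemma measure_finType_bigcup d (T : measurableType d) (R : realType)
    (mu : {measure set T -> \bar R}) (I : finType) (P : pred I) (F : I -> set T) :
  (forall i, measurable (F i)) -> trivIset setT F ->
  mu (\bigcup_(i in [set` P]) F i) = (\sum_(i | P i) mu (F i))%E.
Proof.
move=> mF tF; rewrite measure_fin_bigcup//.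
- apply: esym; apply: bigfs; first exact: index_enum_uniq.
  by move=> i _; rewrite mem_index_enum.
- exact: sub_trivIset tF.
Qed.

Section multinomial_law.
Context {R : realType} (d n : nat) (p : 'cV[R]_d).
Context (disp : measure_display) (T : measurableType disp) (P : probability T R).
Context (K : {RV P >-> d.-tuple nat}).
Hypothesis lawK : is_multinomial n p K.

Lemma measurable_tuple_nat (A : set (d.-tuple nat)) : measurable A.
Proof.
apply: countable_measurable => [t|]; last exact: countableP.
rewrite (_ : [set t] = \bigcap_(i in [set: 'I_d]) ((fun s => tnth s i) @^-1` [set tnth t i])).
  apply: fin_bigcap_measurable => // i _.
  by rewrite -[X in measurable X]setTI; exact: measurable_tnth.
apply/seteqP; split=> s /=; first by move=> -> i _.
by move=> h; apply: eq_from_tnth => i; exact: h.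
Qed.

Let mK (A : set (d.-tuple nat)) : measurable [set w | A (K w)].
Proof.
rewrite (_ : mkset _ = K @^-1` A)// -[X in measurable X]setTI.
by apply: measurable_funPT => //; exact: measurable_tuple_nat.
Qed.

Lemma count_of_inj : injective (@count_of d n).
Proof.
move=> s t /(congr1 (fun k : d.-tuple nat => tnth k)) st; apply: eq_from_tnth => i.
by apply: val_inj; have := congr1 (@^~ i) st; rewrite /= !tnth_map.
Qed.

Let prob_counts (Q : pred (d.-tuple 'I_n.+1)) :
  P (\bigcup_(t in [set` Q]) [set w | K w = count_of t]) =
  (\sum_(t | Q t) multinomial_pmf n p (count_of t))%:E.
Proof.
rewrite measure_finType_bigcup.
- by rewrite -sumEFin; apply: eq_bigr => t _; exact: lawK.
- by move=> t; exact: (mK [set k | k = count_of t]).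
- by apply/trivIsetP => s t _ _; apply: contraNeq => /set0P[w [/= -> /count_of_inj ->]].
Qed.

(** The atoms count_of t already carry total mass 1. *)
Lemma prob_multinomial (A : set (d.-tuple nat)) :
  P [set w | A (K w)] =
  (\sum_(t : d.-tuple 'I_n.+1 | `[< A (count_of t) >]) multinomial_pmf n p (count_of t))%:E.
Proof.
rewrite -prob_counts; set B := \bigcup_(t in _) _.
have mB : measurable B.
  apply: fin_bigcup_measurable => [|t _]; first exact: finite_finpred.
  exact: (mK [set k | k = count_of t]).
pose C := \bigcup_(t in [set` xpredT]) [set w | K w = @count_of d n t].
have mC : measurable C.
  apply: fin_bigcup_measurable => [|t _]; first exact: finite_finpred.
  exact: (mK [set k | k = count_of t]).
have C1 : P (~` C) = 0%E.
  by rewrite probability_setC// prob_counts sum_multinomial_pmf// subee.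
apply/eqP; rewrite eq_le; apply/andP; split.
  rewrite -[leRHS]adde0 -C1; apply: le_trans (measureU2 P mB (measurableC mC)).
  apply: le_measure; rewrite ?inE; [exact: mK|exact: measurableU (measurableC _)|].
  move=> w Aw; have [[t _ wt]|] := pselect (C w); last by right.
  by left; exists t => //=; apply/asboolP; rewrite -wt.
apply: le_measure; rewrite ?inE; [exact: mB|exact: mK|].
by move=> w [t /= /asboolP At ->].
Qed.

End multinomial_law.

Section smoothing.
Context {R : realType} (d n : nat) (p : 'cV[R]_d) (tau : R).
Context (dispK : measure_display) (TK : measurableType dispK) (PK : probability TK R).
Context (dispY : measure_display) (TY : measurableType dispY) (PY : probability TY R).
Context (K : {RV PK >-> d.-tuple nat}) (Y : {RV PY >-> rvec R d}).
Hypotheses (op : open_simplex p) (n_gt0 : (0 < n)%N).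
Hypothesis tau_ge : forall i, (full_prob p i)^-1 <= tau.
Hypotheses (lawK : is_multinomial n p K)
  (lawY : is_mvnormal (n%:R *: p) (n%:R *: Sigma p) Y).

Let mY (A : set (rvec R d)) : measurable A -> measurable [set w | A (Y w)].
Proof.
move=> mA; rewrite (_ : mkset _ = Y @^-1` A)// -[X in measurable X]setTI.
by apply: measurable_funPT.
Qed.

Lemma cube_real_tuple_inj k k' (y : rvec R d) :
  cube (real_tuple k) y -> cube (real_tuple k') y -> k = k'.
Proof.
move=> yk yk'; apply: eq_from_tnth => i.
have := yk i; have := yk' i; rewrite !tnth_mktuple/= !in_itv/=.
move=> /andP[a b] /andP[a' b'].
have h1 : (tnth k i)%:R < (tnth k' i).+1%:R :> R by rewrite -natr1; lra.
have h2 : (tnth k' i)%:R < (tnth k i).+1%:R :> R by rewrite -natr1; lra.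
by apply/eqP; rewrite eqn_leq; apply/andP; split; rewrite -ltnS -(ltr_nat R).
Qed.

Lemma local_error_ge0 k : 0 <= local_error n p tau k.
Proof.
have tau0 : 0 <= tau by apply: le_trans (tau_ge ord_max); rewrite invr_ge0 ltW// full_prob_gt0.
rewrite addr_ge0 ?sumr_ge0// => [|i _]; first by rewrite addr_ge0// ?divr_ge0 ?mulr_ge0.
by rewrite mulr_ge0 ?cosh_deviation_ge0 ?divr_ge0 ?sqrtr_ge0 ?addr_ge0 ?sqr_ge0.
Qed.

(** Each atom of A is at most the normal mass of its cube plus its mass times the
    local error; the cubes are disjoint and lie in B. *)
Lemma multinomial_le_normal (A : set (d.-tuple nat)) (B : set (rvec R d)) :
  measurable B -> (forall k y, A k -> cube (real_tuple k) y -> B y) ->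
  (PK [set w | A (K w)] <= PY [set w | B (Y w)] +
   (\sum_(t : d.-tuple 'I_n.+1)
      multinomial_pmf n p (count_of t) * local_error n p tau (count_of t))%:E)%E.
Proof.
move=> mB AB; rewrite (prob_multinomial lawK).
pose C t := [set w | cube (real_tuple (@count_of d n t)) (Y w)].
have mC t : measurable (C t) by apply: mY; exact: measurable_cube.
have pmf0 t : 0 <= multinomial_pmf n p (@count_of d n t) by exact: multinomial_pmf_ge0.
apply: (@le_trans _ _ (\sum_(t | `[< A (count_of t) >]) PY (C t) +
   (\sum_(t : d.-tuple 'I_n.+1)
      multinomial_pmf n p (count_of t) * local_error n p tau (count_of t))%:E)%E).
  apply: (@le_trans _ _ (\sum_(t | `[< A (@count_of d n t) >])
      ((multinomial_pmf n p (count_of t) * (1 - local_error n p tau (count_of t)))%:E +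
       (multinomial_pmf n p (count_of t) * local_error n p tau (count_of t))%:E))%E).
    rewrite sumEFin lee_fin; apply: ler_sum => t _.
    by rewrite -mulrDr subrK mulr1.
  rewrite big_split/=; apply: leeD.
    apply: lee_sum => t _.
    have [kn|kn] := boolP (\sum_(i < d) tnth (count_of t) i <= n)%N.
      by rewrite /C lawY; [exact: pmf_le_cube_mass|exact: measurable_cube].
    by rewrite {1}/multinomial_pmf (negbTE kn) mul0r measure_ge0.
  rewrite sumEFin lee_fin [leRHS](bigID (fun t => `[< A (count_of t) >]))/= lerDl.
  by apply: sumr_ge0 => t _; rewrite mulr_ge0 ?local_error_ge0.
rewrite leeD2r// -measure_finType_bigcup//; last first.
  apply/trivIsetP => s t _ _; apply: contraNeq => /set0P[w [ws wt]].
  by apply/eqP/(@count_of_inj d n); exact: cube_real_tuple_inj ws wt.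
apply: le_measure; rewrite ?inE; [|exact: mY|].
  by apply: fin_bigcup_measurable => // ; exact: finite_finpred.
by move=> w [t /= /asboolP At]; exact: AB At.
Qed.

End smoothing.

(** * The approximation at a fixed parameter *)

Section pearson_approximation.
Context {R : realType} (d n : nat) (p : 'cV[R]_d) (tau : R).
Context (dispK : measure_display) (TK : measurableType dispK) (PK : probability TK R).
Context (dispY : measure_display) (TY : measurableType dispY) (PY : probability TY R).
Context (K : {RV PK >-> d.-tuple nat}) (Y : {RV PY >-> rvec R d}).
Hypotheses (d_gt0 : (0 < d)%N) (tau_d : d.+1%:R <= tau) (n_ge4 : (4 <= n)%N).
Hypothesis p_tau : prob_set tau p.
Hypotheses (lawK : is_multinomial n p K)
  (lawY : is_mvnormal (n%:R *: p) (n%:R *: Sigma p) Y).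

Let op : open_simplex p. Proof. by case: p_tau. Qed.
Let n_gt0 : (0 < n)%N. Proof. exact: leq_trans n_ge4. Qed.
Let tau_ge i : (full_prob p i)^-1 <= tau.
Proof. by apply: le_trans p_tau.2; exact: le_bigmax. Qed.

Let normal_mass r := PY [set w | chi2_ball n p r (Y w)].

Let normal_massE r : normal_mass r =
  (\int[lebesgue_tuple R d]_(y in chi2_ball n p r) (gauss_density n p y)%:E)%E.
Proof. by rewrite /normal_mass lawY//; exact: measurable_chi2_ball. Qed.

Let F r := fine (normal_mass r).

Let mball r : measurable [set w | chi2_ball n p r (Y w)].
Proof.
rewrite (_ : mkset _ = Y @^-1` chi2_ball n p r)// -[X in measurable X]setTI.
by apply: measurable_funPT => //; exact: measurable_chi2_ball.
Qed.

Let FE r : normal_mass r = (F r)%:E.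
Proof. by rewrite fineK// fin_num_measure//; exact: mball. Qed.

Let F01 r : 0 <= F r <= 1.
Proof.
by rewrite -!lee_fin -FE measure_ge0 probability_le1//; exact: mball.
Qed.

Let F_dilate_ge1 s r : 1 <= s -> F (s * r) <= s ^+ d * F r.
Proof.
move=> s1; rewrite -lee_fin EFinM -!FE !normal_massE.
exact: gauss_ball_dilate_ge1.
Qed.

Let F_dilate_le1 s : 0 < s <= 1 -> F s <= 2 * s ^+ d * F 1.
Proof.
move=> s1; rewrite -lee_fin EFinM -!FE !normal_massE.
exact: gauss_ball_dilate_le1.
Qed.

Variables (ell : R).
Hypothesis ell_gt0 : 0 < ell.

(** The radius, in the norm of Pearson's statistic, of a ball containing all
    cubes after translation of their centres to the origin. *)
Let eta := tau * d.+1%:R / (2 * Num.sqrt n%:R).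
Let E := \sum_(t : d.-tuple 'I_n.+1)
  multinomial_pmf n p (count_of t) * local_error n p tau (count_of t).
Let s := Num.sqrt ell.

Let n0 : 0 < n%:R :> R. Proof. by rewrite ltr0n. Qed.
Let sqn0 : 0 < Num.sqrt n%:R :> R. Proof. by rewrite sqrtr_gt0. Qed.
Let s0 : 0 < s. Proof. by rewrite sqrtr_gt0. Qed.
Let s2 : s ^+ 2 = ell. Proof. by rewrite sqr_sqrtr// ltW. Qed.
Let tau0 : 0 < tau. Proof. by apply: lt_le_trans tau_d; rewrite ltr0n. Qed.
Let eta0 : 0 < eta. Proof. by rewrite divr_gt0 ?mulr_gt0. Qed.

Let pearson_cube (k : d.-tuple nat) (y : rvec R d) (r : R) : 0 < r ->
  cube (real_tuple k) y ->
  (pearson n (col_of_ntuple R k) p <= r ^+ 2 -> chi2_ball n p (r + eta) y) /\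
  (chi2_ball n p r y -> pearson n (col_of_ntuple R k) p <= (r + eta) ^+ 2).
Proof.
move=> r0 ky; rewrite /chi2_ball/= /chi2_stat -col_of_real_tuple !pearsonE//.
set v := col_of_tuple y; set u := col_of_tuple _.
have box : chi2_form p (v - u) <= (Num.sqrt n%:R * eta) ^+ 2 /\
    chi2_form p (u - v) <= (Num.sqrt n%:R * eta) ^+ 2.
  have tb : tau * d%:R * d.+1%:R / 4 <= (Num.sqrt n%:R * eta) ^+ 2.
    have -> : Num.sqrt n%:R * eta = tau * d.+1%:R / 2.
      by rewrite /eta; field; rewrite gt_eqF.
    have t1 : 1 <= tau by apply: le_trans tau_d; rewrite ler1n.
    have dd : d%:R <= d.+1%:R :> R by rewrite ler_nat.
    have d0 : 0 <= d%:R :> R by [].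
    have -> : (tau * d.+1%:R / 2) ^+ 2 = tau * d.+1%:R * (tau * d.+1%:R) / 4 by field.
    rewrite ler_pM2r// [leLHS]mulrAC ler_pM2l ?mulr_gt0//.
    nra.
  have kyi i : (tnth k i)%:R - 2^-1 < (tnth y i : R) < (tnth k i)%:R + 2^-1.
    by have := ky i; rewrite tnth_mktuple /= in_itv.
  split; apply: le_trans tb; apply: chi2_form_box_le => // i; have := kyi i;
    rewrite /u /v !mxE tnth_mktuple ler_norml; lra.
have sq (x : R) : 0 < x -> (Num.sqrt n%:R * x) ^+ 2 = x ^+ 2 * n%:R.
  by move=> x0; rewrite exprMn sqr_sqrtr ?ler0n// mulrC.
have sqr0 : 0 < Num.sqrt n%:R * r by rewrite mulr_gt0.
have sqe0 : 0 < Num.sqrt n%:R * eta by rewrite mulr_gt0.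
rewrite !ler_pdivrMr// -!sq ?addr_gt0// mulrDr.
have e1 : v - n%:R *: p = u - n%:R *: p + (v - u).
  by apply/matrixP => i j; rewrite !mxE; ring.
have e2 : u - n%:R *: p = v - n%:R *: p + (u - v).
  by apply/matrixP => i j; rewrite !mxE; ring.
split=> h; first by rewrite e1; apply: chi2_formD_le => //; exact: box.1.
by rewrite e2; apply: chi2_formD_le => //; exact: box.2.
Qed.

Let prob_K : \bar R := PK [set w | pearson n (col_of_ntuple R (K w)) p <= ell].

Let mpearson_K : measurable [set w | pearson n (col_of_ntuple R (K w)) p <= ell].
Proof.
rewrite (_ : mkset _ = K @^-1` [set k | pearson n (col_of_ntuple R k) p <= ell])//.
rewrite -[X in measurable X]setTI.
by apply: measurable_funPT => //; exact: measurable_tuple_nat.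
Qed.

Let upper : (prob_K <= (F (s + eta) + E)%:E)%E.
Proof.
rewrite EFinD -FE; apply: (multinomial_le_normal op n_gt0 tau_ge lawK lawY
  (A := [set k | pearson n (col_of_ntuple R k) p <= ell])).
  exact: measurable_chi2_ball.
by move=> k y /= kl /(pearson_cube s0)[+ _]; rewrite s2; exact.
Qed.

(** The comparison is one-sided, so the lower bound comes from the event that the
    statistic exceeds ell. *)
Let lower r : 0 < r -> r + eta <= s -> ((F r - E)%:E <= prob_K)%E.
Proof.
move=> r0 rs.
have h : (PK (~` [set w | (pearson n (col_of_ntuple R (K w)) p <= ell)%R]) <=
    PY (~` [set w | chi2_ball n p r (Y w)]) + E%:E)%E.
  apply: (multinomial_le_normal op n_gt0 tau_ge lawK lawY
    (A := [set k | ~ (pearson n (col_of_ntuple R k) p <= ell)])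
    (B := ~` chi2_ball n p r)).
    by apply: measurableC; exact: measurable_chi2_ball.
  move=> k y /= + ky; apply: contra_not => /(pearson_cube r0 ky).2 /le_trans; apply.
  by rewrite -s2 lerXn2r// nnegrE ltW// addr_gt0.
move: h; rewrite (probability_setC PK mpearson_K) (probability_setC PY (mball r)).
rewrite -/prob_K -/(normal_mass r) FE.
have <- : (fine prob_K)%:E = prob_K by rewrite fineK// fin_num_measure.
by rewrite -!EFinB -EFinD !lee_fin; lra.
Qed.

(** The rate without logarithm: 25 comes from the local errors, 1 from the shell of
    width eta about the sphere of radius sqrt ell. *)
Lemma pearson_approximation :
  (`| PK [set w | (pearson n (col_of_ntuple R (K w)) p <= ell)%R] -
     PY [set w | (pearson n (col_of_tuple (Y w)) p <= ell)%R] | <=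
   (26 * tau ^+ 2 * d.+1%:R / Num.sqrt n%:R)%:E)%E.
Proof.
have D0 : 0 < d.+1%:R :> R by rewrite ltr0n.
have d1 : d%:R <= d.+1%:R :> R by rewrite ler_nat.
have dge0 : 1 <= d%:R :> R by rewrite ler1n.
have tau2 : 2 <= tau by apply: le_trans tau_d; rewrite ler_nat.
have V0 : 0 < (Num.sqrt n%:R : R)^-1 by rewrite invr_gt0.
have sqn2 : 2 <= Num.sqrt n%:R :> R.
  by rewrite -[2](@ger0_norm R)// -sqrtr_sqr ler_wsqrtr// -natrX ler_nat.
have V2 : (Num.sqrt n%:R : R)^-1 <= 2^-1 by rewrite lef_pV2 ?posrE.
have nV : (n%:R : R)^-1 = (Num.sqrt n%:R)^-1 ^+ 2.
  by rewrite exprVn sqr_sqrtr ?ler0n.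
(* 16 (tau + tau ^ 2) <= 24 tau ^ 2 as tau >= 2; the terms of order 1 / n take
   the remaining unit. *)
have E_le : E <= 25 * tau ^+ 2 * d.+1%:R / Num.sqrt n%:R.
  apply: (le_trans (sum_local_error_le op n_gt0 tau_ge n_ge4)).
  rewrite !invfM nV; set V := (Num.sqrt n%:R)^-1 in V0 V2 *; set D : R := d.+1%:R in D0 d1 *.
  have DV0 : 0 < D * V by rewrite mulr_gt0.
  have V2V : V ^+ 2 <= V / 2 by nra.
  have h1 : d%:R * (4^-1 * V ^+ 2) <= D * V.
    apply: (@le_trans _ _ (D * (4^-1 * (V / 2)))); last by lra.
    by apply: ler_pM => //; [rewrite mulr_ge0 ?sqr_ge0|rewrite ler_wpM2l].
  have h2 : tau * d%:R * D / 4 * (2^-1 * V ^+ 2) <= tau ^+ 2 / 16 * (D * V).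
    apply: (@le_trans _ _ (tau * tau * D / 4 * (2^-1 * (V / 2)))); last by rewrite expr2; lra.
    have dt : d%:R <= tau by apply: le_trans tau_d.
    apply: ler_pM; rewrite ?mulr_ge0 ?(ltW V0) ?(ltW tau0) ?(ltW D0)//; last by lra.
    by rewrite ler_pM2r// ler_pM2r// ler_pM2l.
  have h3 : D * ((tau + tau ^+ 2) * V * 16) = 16 * (tau + tau ^+ 2) * (D * V) by ring.
  have -> : 25 * tau ^+ 2 * D * V = 25 * tau ^+ 2 * (D * V) by ring.
  rewrite h3; apply: (le_trans (lerD (lerD h1 h2) (lexx _))).
  rewrite -{1}[D * V]mul1r -!mulrDl ler_pM2r//; nra.
have eta_le : 2 * d%:R * eta <= tau ^+ 2 * d.+1%:R / Num.sqrt n%:R.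
  rewrite /eta invfM; set V := (Num.sqrt n%:R)^-1 in V0 *; set D : R := d.+1%:R in D0 d1 *.
  have -> : 2 * d%:R * (tau * D * (2^-1 * V)) = d%:R * (tau * D * V) by field.
  rewrite expr2 -!mulrA ler_pM2r ?mulr_gt0//.
  by apply: le_trans tau_d.
have prob_KE : prob_K = (fine prob_K)%:E by rewrite fineK// fin_num_measure// mpearson_K.
have prob_K0 : 0 <= fine prob_K by apply: fine_ge0; exact: measure_ge0.
have normE : PY [set w | (pearson n (col_of_tuple (Y w)) p <= ell)%R] = (F s)%:E.
  by rewrite -FE /normal_mass /chi2_ball s2.
have RE : 26 * tau ^+ 2 * d.+1%:R / Num.sqrt n%:R =
    25 * tau ^+ 2 * d.+1%:R / Num.sqrt n%:R + tau ^+ 2 * d.+1%:R / Num.sqrt n%:R :> R.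
  by ring.
have Epos : 0 <= 25 * tau ^+ 2 * d.+1%:R / Num.sqrt n%:R.
  by rewrite divr_ge0 ?(ltW sqn0)// mulr_ge0 ?(ltW D0)// mulr_ge0 ?sqr_ge0.
rewrite -/prob_K normE; move: upper lower; rewrite prob_KE.
rewrite -EFinB abse_EFin !lee_fin RE => up low.
have annulus := radial_annulus_le d_gt0 F01 F_dilate_ge1 F_dilate_le1.
rewrite ler_norml; apply/andP; split; last first.
  by have := annulus _ _ s0 eta0; lra.
(* When sqrt ell <= eta the whole ball is small. *)
have [se|es] := leP s eta.
  have := radial_mass_le d_gt0 F01 F_dilate_le1 s0.
  have : 2 * eta <= 2 * d%:R * eta by rewrite ler_pM2r//; lra.
  lra.
have r0 : 0 < s - eta by rewrite subr_gt0.
have := low _ r0; rewrite subrK lexx lee_fin => /(_ isT).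
have := annulus _ _ r0 eta0; rewrite subrK; lra.
Qed.

End pearson_approximation.

(** * The rate *)

Section rate.
Context {R : realType} (d n : nat) (tau : R).
Hypotheses (d_gt0 : (0 < d)%N) (tau_d : d.+1%:R <= tau) (n_tau : tau ^+ 4 <= n%:R).

Let D2 : 2 <= d.+1%:R :> R. Proof. by rewrite ler_nat. Qed.
Let tau2 : 2 <= tau. Proof. exact: le_trans tau_d. Qed.
Let tau_cube : 8 <= tau ^+ 3.
Proof.
have -> : 8 = 2 ^+ 3 :> R by rewrite -natrX.
have t0 : 0 <= tau by have := tau2; lra.
by rewrite lerXn2r ?nnegrE.
Qed.
Let n16 : (16 <= n)%N.
Proof.
rewrite -(ler_nat R); apply: le_trans n_tau; rewrite exprS.
have := tau_cube; have := tau2; nra.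
Qed.
Let n0 : 0 < n%:R :> R. Proof. by rewrite ltr0n; exact: leq_trans n16. Qed.
Let sqn0 : 0 < Num.sqrt n%:R :> R. Proof. by rewrite sqrtr_gt0. Qed.

Definition rate : R :=
  (126 / 100 * tau ^+ 3 * d.+1%:R * ln n%:R `^ (3 / 2)) / Num.sqrt n%:R.

Lemma powR32_sqr (x : R) : 0 <= x -> (x `^ (3 / 2)) ^+ 2 = x ^+ 3.
Proof.
move=> x0; rewrite -powR_mulrn ?powR_ge0// -powRrM -powR_mulrn//; congr powR; lra.
Qed.

(** Since tau >= 2 and (ln n) ^ (3/2) >= 11, already 1.26 * 2 * 11 >= 26. *)
Lemma rate_ge : 5 <= ln n%:R :> R -> 26 * tau ^+ 2 * d.+1%:R / Num.sqrt n%:R <= rate.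
Proof.
move=> L5; rewrite /rate ler_pM2r ?invr_gt0//.
have x11 : 11 <= ln n%:R `^ (3 / 2) :> R.
  have L0 : 0 <= ln n%:R :> R by lra.
  have := powR32_sqr L0; have := powR_ge0 (ln n%:R : R) (3 / 2).
  set x := _ `^ _; set L := ln _ in L5 *; move=> x0 xL.
  have L3 : 125 <= L ^+ 3 by rewrite exprS expr2; nra.
  have [//|/ltW x11] := leP 11 x.
  by have := ler_pM x0 x0 x11 x11; rewrite -expr2 xL; lra.
set x := _ `^ _ in x11 *.
have -> : 126 / 100 * tau ^+ 3 * d.+1%:R * x = (126 / 100 * tau * x) * (tau ^+ 2 * d.+1%:R) by ring.
rewrite -mulrA ler_wpM2r ?mulr_ge0 ?sqr_ge0//; have := tau2; nra.
Qed.

(** For n < expR 5 the rate exceeds 1: sqrt n <= expR (5/2) <= 13, while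
    tau ^ 3 (d + 1) >= 16. *)
Lemma rate_ge1 : ln n%:R < 5 :> R -> 1 <= rate.
Proof.
move=> L5; rewrite /rate ler_pdivlMr// mul1r.
have L1 : 1 <= ln n%:R :> R.
  have : expR 2 <= n%:R :> R.
    by apply: le_trans expR2_le8 _; rewrite ler_nat; exact: leq_trans n16.
  by rewrite -[leRHS]lnK ?posrE// ler_expR; lra.
have x1 : 1 <= ln n%:R `^ (3 / 2) :> R.
  have L0 : 0 <= ln n%:R :> R by lra.
  have := powR32_sqr L0; have := powR_ge0 (ln n%:R : R) (3 / 2).
  set x := _ `^ _; set L := ln _ in L1 *; move=> x0 xL.
  have L3 : 1 <= L ^+ 3 by rewrite exprn_ege1.
  rewrite leNgt; apply/negP => x1.
  by have := ltr_pM x0 x0 x1 x1; rewrite -expr2 xL; lra.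
have sq13 : Num.sqrt n%:R <= 13 :> R.
  have -> : Num.sqrt n%:R = expR (ln n%:R / 2) :> R.
    rewrite -{1}[n%:R]lnK ?posrE//.
    have -> : expR (ln n%:R) = expR (ln n%:R / 2) ^+ 2 :> R.
      by rewrite -expRM_natl; congr expR; lra.
    by rewrite sqrtr_sqr ger0_norm ?expR_ge0.
  by apply: le_trans expR_half5_le; rewrite ler_expR; lra.
apply: (le_trans sq13).
set x := _ `^ _ in x1 *.
have h1 : 16 <= tau ^+ 3 * d.+1%:R by have := tau_cube; have := D2; nra.
have h2 : 16 <= tau ^+ 3 * d.+1%:R * x by nra.
by rewrite [leRHS](_ : _ = 126 / 100 * (tau ^+ 3 * d.+1%:R * x)); [lra|ring].
Qed.

End rate.

Lemma abs_probability_sub_le1 (R : realType) (d1 d2 : measure_display)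
    (T1 : measurableType d1) (T2 : measurableType d2)
    (P1 : probability T1 R) (P2 : probability T2 R) (A : set T1) (B : set T2) :
  measurable A -> measurable B -> (`|P1 A - P2 B| <= 1)%E.
Proof.
move=> mA mB.
have aE : P1 A = (fine (P1 A))%:E by rewrite fineK// fin_num_measure.
have bE : P2 B = (fine (P2 B))%:E by rewrite fineK// fin_num_measure.
have a0 : 0 <= fine (P1 A) by apply: fine_ge0; exact: measure_ge0.
have b0 : 0 <= fine (P2 B) by apply: fine_ge0; exact: measure_ge0.
have a1 : fine (P1 A) <= 1 by rewrite -lee_fin -aE probability_le1.
have b1 : fine (P2 B) <= 1 by rewrite -lee_fin -bE probability_le1.
by rewrite aE bE -EFinB abse_EFin lee_fin ler_norml; apply/andP; split; lra.
Qed.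

Theorem theorem2p7 (R : realType) (d : nat) (d_gt0 : (0 < d)%N)
    (tau : R) (tau_ge : d.+1%:R <= tau) (ell : R) (ell_gt0 : 0 < ell)
    (n : nat) (n_ge : tau ^+ 4 <= n%:R)
    (dispK dispY : measure_display)
    (TK : 'cV[R]_d -> measurableType dispK)
    (TY : 'cV[R]_d -> measurableType dispY)
    (PK : forall p, probability (TK p) R) (PY : forall p, probability (TY p) R)
    (K : forall p, {RV (PK p) >-> d.-tuple nat})
    (Y : forall p, {RV (PY p) >-> rvec R d})
    (lawK : forall p, prob_set tau p -> is_multinomial n p (K p))
    (lawY : forall p, prob_set tau p ->
       is_mvnormal (n%:R *: p) (n%:R *: Sigma p) (Y p)) :
  (ereal_sup
     [set `| PK p [set w | (pearson n (col_of_ntuple R (K p w)) p <= ell)%R]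
           - PY p [set w | (pearson n (col_of_tuple (Y p w)) p <= ell)%R] |
     | p in prob_set tau]
   <= ((126 / 100 * tau ^+ 3 * d.+1%:R * ln n%:R `^ (3 / 2))
       / Num.sqrt n%:R)%R%:E)%E.
Proof.
have n4 : (4 <= n)%N.
  rewrite -(ler_nat R); apply: le_trans n_ge.
  have tau2 : 2 <= tau by apply: le_trans tau_ge; rewrite ler_nat.
  have tau4 : 4 <= tau ^+ 2 by nra.
  by rewrite (exprD tau 2 2); nra.
apply: ge_ereal_sup => _ [p p_tau <-].
have [L5|L5] := leP 5 (ln n%:R : R).
  apply: (@le_trans _ _ (26 * tau ^+ 2 * d.+1%:R / Num.sqrt n%:R)%:E).
    exact: pearson_approximation (lawK p p_tau) (lawY p p_tau) _ _.
  by rewrite lee_fin; exact: rate_ge.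
apply: (@le_trans _ _ 1%E); last by rewrite lee_fin; exact: rate_ge1.
apply: abs_probability_sub_le1.
  rewrite (_ : mkset _ = K p @^-1` [set k | pearson n (col_of_ntuple R k) p <= ell])//.
  rewrite -[X in measurable X]setTI.
  by apply: measurable_funPT => //; exact: measurable_tuple_nat.
rewrite (_ : mkset _ = Y p @^-1` [set y | chi2_stat n p y <= ell])//.
rewrite -[X in measurable X]setTI.
apply: measurable_funPT => //.
have [op _] := p_tau.
have n_gt0 : (0 < n)%N by exact: leq_trans n4.
rewrite -[X in measurable X](_ : chi2_ball n p (Num.sqrt ell) = _).
  exact: measurable_chi2_ball.
by rewrite /chi2_ball sqr_sqrtr// ltW.
Qed.
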